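(* Assume conditions (gu) and (gs) (see context); trajectories of the system $(S_l)$ are not assumed to be globally continuable. Then, for every $\tau\in\mathbb R$, $W^u_{l_u}(\tau)$ and $W^s_{l_s}(\tau)$ are $1$-dimensional immersed manifolds with the following properties: they contain the origin, they are connected, and they are subsets respectively of the sets $$\tilde W^u_{l_u}(\tau)=\{Q\in\mathbb R^2\mid \lim_{t\to-\infty}\boldsymbol{x}_{l_u}(t,\tau,Q)=(0,0)\},\qquad \tilde W^s_{l_s}(\tau)=\{Q\in\mathbb R^2\mid \lim_{t\to+\infty}\boldsymbol{x}_{l_s}(t,\tau,Q)=(0,0)\}.$$
   Context: Here $n>2$, $f:\mathbb R\times(0,\infty)\to\mathbb R$, $(u,r)\mapsto f(u,r)$, is differentiable, $f(0,r)=0$, and super-linear in $u$ (in the precise sense of the conditions below). Condition (H), assumed throughout: $h:(0,\infty)\to\mathbb R$ is differentiable, $h(r)<\frac{(n-2)^2}{4}$ for every $r>0$; $\lim_{r\to0}h(r)=\eta<\frac{(n-2)^2}{4}$ and $\frac{h(r)-\eta}{r}\in L^1(0,1]$; $\lim_{r\to\infty}h(r)=\beta<\frac{(n-2)^2}{4}$ and $\frac{h(r)-\beta}{r}\in L^1[1,\infty)$. For $\eta<\frac{(n-2)^2}{4}$: $2_*(\eta)=2\frac{n+\sqrt{(n-2)^2-4\eta}}{n-2+\sqrt{(n-2)^2-4\eta}}$; ${\rm I}(\eta)=+\infty$ if $\eta\le0$ and ${\rm I}(\eta)=2\frac{n-\sqrt{(n-2)^2-4\eta}}{n-2-\sqrt{(n-2)^2-4\eta}}$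 if $0<\eta<\frac{(n-2)^2}{4}$. The same formulas with $\beta$ in place of $\eta$. For $l>2$ put $\alpha_l=\frac{2}{l-2}$, $\gamma_l=\alpha_l+2-n$, $g_l(x,t)=f(xe^{-\alpha_lt},e^t)\,e^{(\alpha_l+2)t}$. System $(S_l)$ is $$\dot x=\alpha_lx+y,\qquad \dot y=-h(e^t)x+\gamma_ly-g_l(x,t),$$ and $\boldsymbol{x}_l(t,\tau,Q)$ denotes its trajectory which is at $Q\in\mathbb R^2$ at time $t=\tau$ (membership in $\tilde W^u_{l_u}(\tau)$, resp. $\tilde W^s_{l_s}(\tau)$, includes that the trajectory is defined for all $t\le\tau$, resp. $t\ge\tau$). Condition (gu): (H) holds and there is $l_u\in(2_*(\eta),{\rm I}(\eta))$ such that, for every $\tau\in\mathbb R$, $g_{l_u}(x,t)$ is continuous in $x$, for $x$ in any compact set, uniformly for $t\le\tau$; and $g_{l_u}(0,t)=\partial_xg_{l_u}(0,t)=0$ for all $t\in\mathbb R$. Condition (gs): (H) holds and there is $l_s\in(2_*(\beta),{\rm I}(\beta))$ such that, for every $\tau\in\mathbb R$, $g_{l_s}(x,t)$ is continuous in $x$, for $x$ in any compact set, uniformly for $t\ge\tau$; and $g_{l_s}(0,t)=\partial_xg_{l_s}(0,t)=0$ for all $t\in\mathbb R$. $W^u_{l_u}(\tau)$ (resp. $W^s_{l_s}(\tau)$) denotes the connected component containing the origin of $\tilde W^u_{l_u}(\tau)$ (resp. $\tilde W^s_{l_s}(\tau)$). The manifolds are only immersed: they may fail to be usual submanifolds at the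 origin (e.g. they may be 8-shaped).
   Formalization: In (gu) and (gs), continuity in x on compact sets, uniformly in t, is required of the x-derivative of g_l as well as of g_l; with g_l alone the claim fails (the set of points tending to the origin can be the whole plane) and trajectories need not be unique. *)

(* Defs.v *)
From HB Require Import structures.
From mathcomp Require Import all_boot all_order all_algebra.
From mathcomp Require Import all_classical all_reals all_analysis.

Set Implicit Arguments.
Unset Strict Implicit.
Unset Printing Implicit Defensive.

Import Order.TTheory GRing.Theory Num.Theory.
Import numFieldNormedType.Exports.

Local Open Scope classical_set_scope.
Local Open Scope ring_scope.

Section Immersed.
Context {R : realType}.

Definition C1_regular (V : set R) (gamma : R -> R * R) : Prop :=
  forall s, V s ->
    [/\ derivable gamma s 1, {for s, continuous (derive1 gamma)}
      & derive1 gamma s != 0].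

(* [c] is a homeomorphism, with inverse [a], of an open set of the line onto
   an open neighbourhood of [p], and [iota \o c] is a C^1 immersion. *)
Definition immersed_chart_at (N : topologicalType) (iota : N -> R * R)
    (p : N) : Prop :=
  exists (U : set N) (V : set R) (a : N -> R) (c : R -> N),
    [/\ open U, U p & open V] /\
    [/\ a @` U = V, c @` V = U, {in U, cancel a c} & {in V, cancel c a}] /\
    [/\ {within U, continuous a}, {within V, continuous c}
      & C1_regular V (iota \o c)].

(* [M] is the image of a 1-dimensional manifold [N] (Hausdorff, second
   countable) under an injective C^1 immersion.  No C^1 atlas on [N] has to be
   given: the parametrizations [c] above are automatically C^1-compatible,
   because each [iota \o c] is C^1 with nonzero velocity.  The topology of [N]
   may be finer than the one induced by the plane (figure eight), and [N] may
   have several components although [M] is connected in the plane. *)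
Definition immersed_1manifold (M : set (R * R)) : Prop :=
  exists (N : topologicalType) (iota : N -> R * R),
    [/\ hausdorff_space N, @second_countable N, injective iota, range iota = M
      & forall p : N, immersed_chart_at iota p].

End Immersed.

Section Fowler.
Context {R : realType}.
Variables (n : R) (f : R -> R -> R) (h : R -> R).

Definition hardy_const : R := (n - 2) ^+ 2 / 4.

Definition condH (eta beta : R) : Prop :=
  [/\ forall r, 0 < r -> derivable h r 1
    & forall r, 0 < r -> h r < hardy_const] /\
  [/\ h r @[r --> 0^'+] --> eta, eta < hardy_const
    & lebesgue_measure.-integrable `]0, 1]
        (fun r : R => ((h r - eta) / r)%:E)] /\
  [/\ h r @[r --> +oo%R] --> beta, beta < hardy_const
    & lebesgue_measure.-integrable `[1, +oo[
        (fun r : R => ((h r - beta) / r)%:E)].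

Definition two_star (e : R) : R :=
  2 * ((n + Num.sqrt ((n - 2) ^+ 2 - 4 * e)) /
       (n - 2 + Num.sqrt ((n - 2) ^+ 2 - 4 * e))).

Definition I_exp (e : R) : \bar R :=
  if e <= 0 then +oo%E
  else (2 * ((n - Num.sqrt ((n - 2) ^+ 2 - 4 * e)) /
             (n - 2 - Num.sqrt ((n - 2) ^+ 2 - 4 * e))))%:E.

Definition alpha_ (l : R) : R := 2 / (l - 2).
Definition gamma_ (l : R) : R := alpha_ l + 2 - n.

Definition g_ (l x t : R) : R :=
  f (x * expR (- (alpha_ l * t))) (expR t) * expR ((alpha_ l + 2) * t).

Definition dg_ (l x t : R) : R := derive1 (fun z => g_ l z t) x.

Definition unif_cont_on_compacts (k : R -> R -> R) (T : set R) : Prop :=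
  forall K : set R, compact K -> forall e : R, 0 < e ->
    exists2 d : R, 0 < d &
      forall x x' t : R, K x -> K x' -> T t -> `|x - x'| < d ->
        `|k x t - k x' t| < e.

(* The uniform continuity is required of [g_ l] and of its x-derivative
   [dg_ l].  With [g_ l] alone, the pointwise condition [dg_ l 0 t = 0] does not
   make the nonlinearity uniformly small near x = 0: one may take it linear,
   c * x with c and m large, outside |x| < exp (m * t), and then the set of points whose
   trajectories tend to the origin can have interior. *)
Definition cond_gu (eta lu : R) : Prop :=
  [/\ two_star eta < lu, (lu%:E < I_exp eta)%E,
      forall tau : R,
        unif_cont_on_compacts (g_ lu) [set t | t <= tau] /\
        unif_cont_on_compacts (dg_ lu) [set t | t <= tau]
    & forall t : R, g_ lu 0 t = 0 /\ dg_ lu 0 t = 0].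

Definition cond_gs (beta ls : R) : Prop :=
  [/\ two_star beta < ls, (ls%:E < I_exp beta)%E,
      forall tau : R,
        unif_cont_on_compacts (g_ ls) [set t | tau <= t] /\
        unif_cont_on_compacts (dg_ ls) [set t | tau <= t]
    & forall t : R, g_ ls 0 t = 0 /\ dg_ ls 0 t = 0].

Definition trajectory (l tau : R) (Q : R * R) (J : set R) (X : R -> R * R)
  : Prop :=
  [/\ open J, is_interval J, J tau, X tau = Q
    & forall t : R, J t ->
        is_derive t 1 (fun s => (X s).1) (alpha_ l * (X t).1 + (X t).2) /\
        is_derive t 1 (fun s => (X s).2)
          (- h (expR t) * (X t).1 + gamma_ l * (X t).2 - g_ l (X t).1 t)].

Definition tildeWu (l tau : R) : set (R * R) :=
  [set Q | exists (J : set R) (X : R -> R * R),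
    [/\ trajectory l tau Q J X, [set t | t <= tau] `<=` J
      & X t @[t --> -oo%R] --> ((0, 0) : R * R)]].

Definition tildeWs (l tau : R) : set (R * R) :=
  [set Q | exists (J : set R) (X : R -> R * R),
    [/\ trajectory l tau Q J X, [set t | tau <= t] `<=` J
      & X t @[t --> +oo%R] --> ((0, 0) : R * R)]].

Definition Wu (l tau : R) : set (R * R) :=
  connected_component (tildeWu l tau) (0, 0).

Definition Ws (l tau : R) : set (R * R) :=
  connected_component (tildeWs l tau) (0, 0).

End Fowler.

(* Main.v *)
(* In the coordinates u = y + a x, v = y + b x, with a + b = n - 2 and ab = eta, the
   linear part at t = -oo is diagonal and, by the bounds on l, a saddle.  For T close to
   -oo, clamp the nonlinearity at a level |u - v| = kappa(t) which is small for t <= T and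
   grows afterwards: the clamped system has a small Lipschitz constant before T and a
   large one after T.  The Lyapunov-Perron operator is then a contraction in a weighted
   sup norm over the whole line, so that for every s the clamped system has exactly
   one solution with u(T) = s that is bounded at -oo; it decays, and it depends on s in a
   C^1 way with nonzero derivative, the derivative solving the variational equation.
   Evaluation at time tau of those solutions which stay below the clamping level gives
   a chart, and countably many pairs (T, kappa) exhaust the set of all points whose
   backward trajectory tends to the origin.  Uniqueness of the bounded solution makes the
   transition maps continuous, so the set with the final topology of the charts is
   a 1-manifold; a plane connected component is a union of intrinsic ones.  The stable
   manifold follows by reversing time. *)
From HB Require Import structures.
Require Import Defs.
From mathcomp Require Import all_boot all_order all_algebra.
From mathcomp Require Import all_classical all_reals all_analysis.
From mathcomp Require Import ring lra.
Import Order.TTheory GRing.Theory Num.Theory.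
Import numFieldNormedType.Exports.
Local Open Scope classical_set_scope.
Local Open Scope ring_scope.

(** * Manifolds from families of charts *)

(** Trajectories need not extend up to [tau], so a local manifold cannot be transported by a flow of
    the plane: the modified equation is solved directly up to [tau], and the parameters whose
    solutions are genuine are selected afterwards. The nonlinearity enters only the second equation
    of the system and depends on [x = (u - v) / (a - b)]. Hence both diagonal equations carry the
    same forcing term, and the fixed point is sought for the single function [u - v]. The term
    [(h - eta) * x] is counted as nonlinear. Its slope at zero only tends to 0 at [-oo], so
    smallness requires both a small argument and an early time. The constants are chosen so that a
    forcing of size [lip * B * wt] produces at most [B / 4 * wt] in each component, hence a factor
    1/2 for [u - v]. The rate [th] before [T] takes two values: [lam / 2] makes the constructed
    solutions decay, and 0 gives uniqueness among all bounded ones. *)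

Section chart_families.
Context {R : realType}.
Implicit Types (M : set (R * R)) (V : nat -> set R) (c : nat -> R -> R * R).

(** Transition maps are not named. The last clause says that near [s] the points of chart [j] are
    reached by chart [k] at parameters near [s']; with injectivity this is openness of the overlap
    and continuity of the transition. *)
Definition chart_family M V c : Prop :=
  [/\ forall k, open (V k), forall k s, V k s -> M (c k s),
      forall p, M p -> exists k, exists2 s, V k s & c k s = p
    & forall k s s', V k s -> V k s' -> c k s = c k s' -> s = s'] /\
  [/\ forall k, C1_regular (V k) (c k)
    & forall j k s s', V j s -> V k s' -> c j s = c k s' ->
        forall O, nbhs s' O ->
        \forall z \near s, exists2 z', O z' /\ V k z' & c j z = c k z'].

(** Carrying [V] and [c] in the type allows a topology that depends on the charts, instead of the
    one induced by the plane. *)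
Definition leaf_space M V c : Type := set_type M.

Section leaf_topology.
Variables (M : set (R * R)) (V : nat -> set R) (c : nat -> R -> R * R).
Local Notation N := (leaf_space M V c).
Local Notation iota := (fun q : N => val (q : set_type M)).

HB.instance Definition _ := Choice.copy N (set_type M).

(* The final topology of the maps [c k] on [V k]. *)
Definition leaf_open (O : set N) : Prop :=
  forall k s (q : N), V k s -> O q -> iota q = c k s ->
    \forall z \near s, forall q' : N, iota q' = c k z -> O q'.

Fact leaf_openT : leaf_open setT.
Proof. by move=> k s q _ _ _; apply: filterE => z q1 _; exact: I. Qed.

Fact leaf_openI : setI_closed leaf_open.
Proof.
move=> A B oA oB k s q Vs [Aq Bq] e.
move: (oA k s q Vs Aq e) (oB k s q Vs Bq e); apply: filterS2 => z hA hB q' e'.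
by split; [exact: hA|exact: hB].
Qed.

Fact leaf_open_bigU (I : Type) (f : I -> set N) :
  (forall i, leaf_open (f i)) -> leaf_open (\bigcup_i f i).
Proof.
move=> of_ k s q Vs [i _ fq] e.
by move: (of_ i k s q Vs fq e); apply: filterS => z h q' e'; exists i => //; exact: h.
Qed.

HB.instance Definition _ :=
  isOpenTopological.Build N leaf_openT leaf_openI leaf_open_bigU.

End leaf_topology.

Lemma leaf_openE M V c (O : set (leaf_space M V c)) : open O = leaf_open M V c O.
Proof. by []. Qed.

Lemma C1_regular_continuous (W : set R) (g : R -> R * R) s :
  C1_regular W g -> W s -> {for s, continuous g}.
Proof.
move=> reg /reg[dg _ _].
by apply: differentiable_continuous; exact/derivable1_diffP.
Qed.

Section immersed.
Variables (M : set (R * R)) (V : nat -> set R) (c : nat -> R -> R * R).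
Hypothesis Mch : chart_family M V c.
Local Notation N := (leaf_space M V c).
Let iota (q : N) : R * R := val (q : set_type M).

Let iota_inj : injective iota.
Proof. by move=> p q /val_inj. Qed.

Let iotaM q : M (iota q).
Proof. by have := valP (q : set_type M); rewrite inE. Qed.

Let openV k : open (V k). Proof. by case: Mch => -[]. Qed.

(** The final topology refines the plane one because every [c k] is continuous on [V k]; the
    Hausdorff property is inherited through this map. *)
Let iota_continuous : continuous iota.
Proof.
apply/continuousP => A oA; rewrite leaf_openE => k s q Vs Aq e.
have [reg _] := Mch.2.
have As : nbhs (c k s) A by apply: open_nbhs_nbhs; split; rewrite // -e.
have cA : nbhs s (c k @^-1` A) := C1_regular_continuous _ _ _ (reg k) Vs A As.
by apply: filterS cA => z cz q' e'; rewrite /preimage /= /iota e'.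
Qed.

(** The default [q0] only makes the map total: on [V k] the first branch is always taken. *)
Definition leaf_param k (q0 : N) (s : R) : N :=
  if pselect (M (c k s)) is left m then exist _ (c k s) (mem_set m) else q0.

Let leaf_paramE k q0 s : V k s -> iota (leaf_param k q0 s) = c k s.
Proof.
move=> Vs; rewrite /leaf_param; case: pselect => //= h.
by exfalso; apply: h; case: Mch => -[_ h _ _] _; exact: h.
Qed.

Let leaf_param_continuous k q0 s : V k s -> {for s, continuous (leaf_param k q0)}.
Proof.
move=> Vs A /=; rewrite nbhsE /= => -[B [oB Bs] BA].
have := oB k s _ Vs Bs (leaf_paramE k q0 s Vs).
move=> hB; have := openV k; rewrite openE => /(_ _ Vs) nV.
suff : nbhs s (leaf_param k q0 @^-1` A) by [].
by move: hB nV; apply: filterS2 => z hz Vz; apply/BA/hz; exact: leaf_paramE.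
Qed.

(** Openness has to be tested against every chart [j], which is exactly what the transition clause
    of [chart_family] provides. *)
Let leaf_param_open k q0 (O : set R) : open O -> O `<=` V k ->
  open (leaf_param k q0 @` O).
Proof.
move=> oO OV; rewrite leaf_openE => j s q Vjs [s' Os' <-] e.
have Vs' := OV _ Os'.
have [_ tr] := Mch.2.
have e' : c j s = c k s' by rewrite -(leaf_paramE k q0 s' Vs') -e.
have nO : nbhs s' O by apply: open_nbhs_nbhs; split.
have := tr j k s s' Vjs Vs' e' O nO.
apply: filterS => z [z' [Oz' Vz'] ez] q' eq'.
by exists z' => //; apply: iota_inj; rewrite leaf_paramE// -ez; exact/esym.
Qed.

Let leaf_hausdorff : hausdorff_space N.
Proof.
move=> p q cpq; apply: iota_inj; apply: (@norm_hausdorff R (R * R)%type) => A B nA nB.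
have [x [Ax Bx]] := cpq _ _ (iota_continuous p A nA) (iota_continuous q B nB).
by exists (iota x).
Qed.

(** A countable base consists of the images of intervals with rational ends, one countable supply
    for each of the countably many charts. *)
Let leaf_second_countable (q0 : N) : @second_countable N.
Proof.
pose D := [set: nat * rat * rat].
pose b (x : nat * rat * rat) : set N :=
  leaf_param x.1.1 q0 @` (`]ratr x.1.2, ratr x.2[%classic `&` V x.1.1).
have ob x : open (b x).
  apply: leaf_param_open; last exact: subIsetr.
  by apply: openI => //; exact: itv_open.
exists (b @` D); first exact: card_le_trans (card_image_le _ _) (countableP _).
split; first by move=> _ [x _ <-]; exact: ob.
move=> q A; rewrite nbhsE => -[B [oB Bq] BA].
have [[_ _ Mc injc] _] := Mch.
have [k [s Vs es]] := Mc _ (iotaM q).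
have qE : q = leaf_param k q0 s by apply: iota_inj; rewrite leaf_paramE.
have := oB k s q Vs Bq (esym es) => hB.
have nV : nbhs s (V k) by apply: open_nbhs_nbhs; split.
have [/= e e0 he] : nbhs s [set z | V k z /\ forall q', iota q' = c k z -> B q'].
  by move: hB nV; apply: filterS2.
have se1 : s - e < s by rewrite ltrBlDr ltrDl.
have se2 : s < s + e by rewrite ltrDl.
have [x /itvP xs] := rat_in_itvoo se1; have [y /itvP ys] := rat_in_itvoo se2.
exists (b (k, x, y)) => /=.
  split; first by exists (k, x, y).
  exists s; last by rewrite -qE.
  by split=> //; rewrite /= in_itv /= xs ys.
move=> _ [z [zxy Vz] <-]; apply: BA.
move: zxy; rewrite /= in_itv /= => /andP[xz zy].
have [] : V k z /\ forall q', iota q' = c k z -> B q'.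
  apply: he; rewrite /= ltr_norml; apply/andP; split.
  - have : z < s + e by apply: lt_trans zy _; rewrite ys.
    lra.
  - have : s - e < z by apply: lt_trans xz; rewrite xs.
    lra.
by move=> _; apply; exact: leaf_paramE.
Qed.

Lemma immersed_of_charts : M !=set0 -> immersed_1manifold M.
Proof.
move=> [p0 Mp0]; pose q0 : N := exist _ p0 (mem_set Mp0).
have [[_ _ Mc injc] [reg _]] := Mch.
exists N, iota; split=> //; first exact: leaf_second_countable q0.
  by apply/seteqP; split=> [_ [q _ <-]//|p Mp]; exists (exist _ p (mem_set Mp) : N).
move=> q; have [k [s Vs es]] := Mc _ (iotaM q).
pose C := leaf_param k q0; pose U := C @` V k.
have CV : forall z, V k z -> iota (C z) = c k z by move=> z; exact: leaf_paramE.
pose a (p : N) : R := if pselect (U p) is left u then sval (cid2 u) else 0.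
have aP p : U p -> V k (a p) /\ C (a p) = p.
  by move=> Up; rewrite /a; case: pselect => // u; case: cid2.
have aK z : V k z -> a (C z) = z.
  move=> Vz; have [Va Ca] := aP (C z) (ex_intro2 _ _ z Vz erefl).
  by apply: (injc k) => //; rewrite -!CV// Ca.
exists U, (V k), a, C; split; [|split].
- split=> //; first exact: leaf_param_open.
  by exists s => //; apply: iota_inj; rewrite CV.
- split.
  + apply/seteqP; split=> [_ [p /aP[? _] <-]//|z Vz].
    by exists (C z); [exists z|exact: aK].
  + by [].
  + by move=> p; rewrite inE => /aP[].
  + by move=> z; rewrite inE => /aK.
split.
(* The inverse of the parametrization is continuous because the parametrization is an open map. *)
- apply/subspace_continuousP => p Up A; rewrite nbhsE /= => -[W [oW Wap] WA].
  have [Vap Cap] := aP p Up.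
  have : nbhs p (C @` (W `&` V k)).
    apply: open_nbhs_nbhs; split; last by exists (a p).
    by apply: leaf_param_open; [exact: openI|exact: subIsetr].
  apply: filterS => _ [z [Wz Vz] <-] _.
  by have aW : W (a (C z)); [rewrite aK|exact: WA].
- apply/continuous_in_subspaceT => z; rewrite inE => Vz.
  exact: leaf_param_continuous.
- move=> z Vz; have [d1 d2 d3] := reg k z Vz.
  have E : \near z, (iota \o C) z = c k z.
    have : nbhs z (V k) by apply: open_nbhs_nbhs; split.
    by apply: filterS => x Vx; exact: CV.
  have E' : \near z, derive1 (iota \o C) z = derive1 (c k) z.
    have : nbhs z (V k) by apply: open_nbhs_nbhs; split.
    apply: filterS => x Vx; rewrite !derive1E; apply: near_eq_derive.
    have : nbhs x (V k) by apply: open_nbhs_nbhs; split.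
    by apply: filterS => y Vy; exact: CV.
  have E0 : derive1 (iota \o C) z = derive1 (c k) z by exact: (nbhs_singleton E').
  split.
  + apply: (near_eq_derivable _ d1).
    by apply: filterS E => x ->.
  + rewrite /prop_for /continuous_at E0.
    by apply: cvg_trans d2; apply: near_eq_cvg; apply: filterS E' => x ->.
  + by rewrite E0.
Qed.

End immersed.

Lemma chart_family_component M V c (p : R * R) : chart_family M V c ->
  chart_family (connected_component M p)
    (fun k => V k `&` c k @^-1` connected_component M p) c.
Proof.
move=> [[oV cM Mc injc] [reg tr]].
set K := connected_component M p.
(* The image of a ball inside [V k] is a connected part of [M], so it cannot leave the component;
   hence the restricted parameter domains remain open. *)
have loc k s : V k s -> K (c k s) -> \forall z \near s, V k z /\ K (c k z).
  move=> Vs Ks; have := oV k; rewrite openE => /(_ _ Vs)[/= e e0 he].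
  exists e => //= z ze; split; first exact: he.
  have Ve : ball s e `<=` V k by [].
  apply: (connected_component_trans Ks).
  apply: (@connected_component_max _ M (c k @` ball s e) (c k s)).
  - by exists s => //; exact: ballxx.
  - by move=> _ [y /Ve Vy <-]; exact: cM.
  - apply: connected_continuous_connected.
      by apply/connected_intervalP; rewrite ball_itv; exact: interval_is_interval.
    apply/continuous_in_subspaceT => y; rewrite inE => /Ve Vy.
    exact: C1_regular_continuous (reg k) Vy.
  - by exists z.
split; split.
- move=> k; rewrite openE => s [Vs Ks]; exact: loc.
- by move=> k s [].
- move=> q Kq; have [k [s Vs es]] := Mc q (connected_component_sub Kq).
  by exists k, s => //; split => //; rewrite /preimage /= es.
- by move=> k s s' [Vs _] [Vs' _]; exact: injc.
- by move=> k s [Vs _]; exact: reg.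
- move=> j k s s' [Vs Ks] [Vs' Ks'] e O nO.
  have nO' : nbhs s' (O `&` [set x | V k x /\ K (c k x)]).
    by apply: filterI => //; exact: loc.
  apply: filterS (tr j k s s' Vs Vs' e _ nO') => z [z' [[Oz' [_ Kz']] Vz'] ez].
  by exists z'.
Qed.

End chart_families.

(** * Exponential dichotomy estimates *)

Section barriers.
Context {R : realType}.
Implicit Types (u v b z dz : R -> R) (t : R).

Lemma is_derive_continuous z t d : is_derive t (1 : R) z d -> {for t, continuous z}.
Proof. by move=> [dz _]; apply: differentiable_continuous; exact/derivable1_diffP. Qed.

Lemma le_of_derive_ge0 z dz (t0 t1 : R) : t0 <= t1 ->
  (forall t, t0 <= t <= t1 -> is_derive t 1 z (dz t)) ->
  (forall t, t0 <= t <= t1 -> 0 <= dz t) -> z t0 <= z t1.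
Proof.
move=> le01 dzE dz0.
have [c c01 zE] : exists2 c, c \in `[t0, t1] & z t1 - z t0 = dz c * (t1 - t0).
  apply: MVT_segment => // [x|]; last first.
    apply/continuous_in_subspaceT => x; rewrite inE /= in_itv => /= h.
    exact: is_derive_continuous (dzE x h).
  by rewrite in_itv /= => /andP[/ltW h1 /ltW h2]; apply: dzE; rewrite h1.
by rewrite -subr_ge0 zE mulr_ge0 ?subr_ge0// dz0.
Qed.

Lemma is_derive_expRM (a c t : R) :
  is_derive t 1 (fun r => expR (a * (r - c))) (a * expR (a * (t - c))).
Proof.
have h : is_derive t 1 (fun r : R => a * (r - c)) a.
  by apply: is_derive_eq; rewrite /GRing.scale /=; ring.
by rewrite mulrC; apply: (@is_derive1_comp _ expR (fun r => a * (r - c))).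
Qed.

Lemma expR_small (C d : R) : 0 < C -> 0 < d -> exists2 x, 0 < x & C * expR (- x) < d.
Proof.
move=> C0 d0; have Cd : 0 < C / d by rewrite divr_gt0.
(* The witness comes from [expR x > 1 + x] at [x = C / d]. *)
exists (C / d) => //; rewrite expRN ltr_pdivrMr ?expR_gt0 //.
have := expR_gt1Dx (lt0r_neq0 Cd); rewrite -(ltr_pM2l d0); apply: lt_trans.
by rewrite mulrDr mulrCA divff ?lt0r_neq0 // !mulr1 ltrDr.
Qed.

(* Multiplying by the integrating factor makes the distance of [v] to the
   barrier [K * exp (th * (t - T))] monotone; [K] may have any sign. *)
Lemma barrier v b (m K th T t0 t1 : R) : t0 <= t1 ->
  (forall t, t0 <= t <= t1 -> is_derive t 1 v (m * v t + b t)) ->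
  (forall t, t0 <= t <= t1 -> b t <= K * (th - m) * expR (th * (t - T))) ->
  (v t1 - K * expR (th * (t1 - T))) * expR (- m * (t1 - T)) <=
  (v t0 - K * expR (th * (t0 - T))) * expR (- m * (t0 - T)).
Proof.
move=> le01 dv bE.
pose z t := (K * expR (th * (t - T)) - v t) * expR (- m * (t - T)).
suff : z t0 <= z t1 by rewrite /z; lra.
pose dz t := (K * (th - m) * expR (th * (t - T)) - b t) * expR (- m * (t - T)).
apply: (@le_of_derive_ge0 z dz t0 t1 le01) => t ht; last first.
  by rewrite /dz mulr_ge0 ?expR_ge0 // subr_ge0 bE.
have h1 := dv t ht.
have h2 := is_derive_expRM th T t.
have h3 := is_derive_expRM (- m) T t.
by rewrite /z; apply: is_derive_eq; rewrite /dz /GRing.scale /=; ring.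
Qed.

End barriers.

Section dichotomy.
Context {R : realType}.
Variables (lam mu nu eps L T : R).
Hypotheses (lam0 : 0 < lam) (mu0 : 0 < mu) (eps0 : 0 < eps)
  (eps_lam : eps <= lam / 8) (eps_mu : eps <= mu / 4) (eps_L : eps <= L)
  (L_nu : L <= (nu - lam) / 4).

Let consts : [/\ 0 < lam, 0 < mu & 0 < eps] /\
  [/\ eps <= lam / 8, eps <= mu / 4, eps <= L & L <= (nu - lam) / 4].
Proof. by []. Qed.

(* The Lipschitz constant [L] after [T] may be large; a growth rate [nu >= lam + 4 L] of
   the weight after [T] nevertheless makes the integral operators contract. *)
Definition wt (th t : R) : R := expR ((if t <= T then th else nu) * (t - T)).
Definition lip (t : R) : R := if t <= T then eps else L.

Lemma wt_gt0 (th t : R) : 0 < wt th t. Proof. exact: expR_gt0. Qed.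
Lemma lip_ge (t : R) : eps <= lip t. Proof. by rewrite /lip; case: ifP. Qed.
Lemma lip_gt0 (t : R) : 0 < lip t. Proof. exact: lt_le_trans (lip_ge t). Qed.

Lemma wtT (th : R) : wt th T = 1.
Proof. by rewrite /wt subrr mulr0 expR0. Qed.

(** There is no initial value, only the crude bound [C] towards [-oo]. An excess [d] over the
    barrier at some time before [T] would grow backwards at rate [mu] and eventually exceed [C].
    After [T] the barrier is followed forwards from [T] at rate [nu]. *)
Lemma stable_ub (th t1 C B : R) (v b : R -> R) : T <= t1 -> 0 <= th -> 0 <= B ->
  (forall t, t <= t1 -> is_derive t 1 v (- mu * v t + b t)) ->
  (forall t, t <= T -> v t <= C) ->
  (forall t, t <= t1 -> b t <= lip t * (B * wt th t)) ->
  forall t, t <= t1 -> v t <= B / 4 * wt th t.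
Proof.
have [[l0 m0 e0] [el em eL Ln]] := consts.
move=> Tt1 th0 B0 dv vC bB.
have early t : t <= T -> v t <= B / 4 * wt th t.
  move=> tT; rewrite /wt tT leNgt; apply/negP => lt_v.
  set d := v t - B / 4 * expR (th * (t - T)).
  have d0 : 0 < d by rewrite /d; lra.
  have key t' : t' <= t -> d * expR (mu * (t - T)) <= v t' * expR (mu * (t' - T)).
    move=> t't.
    have := @barrier R v b (- mu) (B / 4) th T t' t t't; rewrite !opprK -/d => H.
    apply: le_trans (H _ _) _.
    - by move=> r /andP[_ rt]; apply: dv; lra.
    - move=> r /andP[_ rt]; have rT : r <= T by lra.
      apply: le_trans (bB r _) _; first lra.
      rewrite /lip /wt rT; set x := expR _.
      have x0 : 0 < x := expR_gt0 _.
      have Bx : 0 <= B * x by rewrite mulr_ge0 // ltW.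
      have -> : B / 4 * (th + mu) * x = (th + mu) / 4 * (B * x) by field.
      by apply: ler_wpM2r => //; lra.
    - rewrite ler_wpM2r ?expR_ge0 // lerBlDr lerDl mulr_ge0 ?expR_ge0 //; lra.
  have C0 : 0 < C.
    have := key t (lexx _); rewrite ler_pM2r ?expR_gt0 // => h.
    by apply: lt_le_trans d0 (le_trans h (vC _ tT)).
  have [r rt hr] : exists2 r, r <= 0 & C * expR (mu * r) < d.
    have [x x0 xE] := expR_small _ _ C0 d0.
    exists (- (x / mu)); first by rewrite oppr_le0 ltW // divr_gt0.
    by rewrite mulrN mulrCA divff ?mulr1 ?lt0r_neq0.
  have ht' : t + r <= t by lra.
  have := key _ ht'.
  have -> : mu * (t + r - T) = mu * (t - T) + mu * r by ring.
  rewrite expRD [leRHS]mulrCA [leLHS]mulrC ler_pM2l ?expR_gt0 //.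
  have : v (t + r) * expR (mu * r) <= C * expR (mu * r).
    by rewrite ler_pM2r ?expR_gt0 // vC //; lra.
  lra.
move=> t tt1; have [tT|Tt] := leP t T; first exact: early.
have := @barrier R v b (- mu) (B / 4) nu T T t (ltW Tt); rewrite !opprK => H.
have {H} : (v t - B / 4 * expR (nu * (t - T))) * expR (mu * (t - T)) <= 0.
  apply: le_trans (H _ _) _.
  - by move=> r /andP[_ rt]; apply: dv; lra.
  - move=> r /andP[Tr rt].
    apply: le_trans (bB r _) _; first lra.
    have : lip r <= L by rewrite /lip; case: ifP.
    move=> lr; have : wt th r = expR (nu * (r - T)).
      rewrite /wt; case: ifP => // rT.
      by have -> : r = T; [apply/eqP; rewrite eq_le rT|rewrite subrr !mulr0].
    move=> ->; set x := expR _; have x0 : 0 < x := expR_gt0 _.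
    have Bx : 0 <= B * x by rewrite mulr_ge0 // ltW.
    have -> : B / 4 * (nu + mu) * x = (nu + mu) / 4 * (B * x) by field.
    by apply: ler_wpM2r => //; lra.
  - have := early T (lexx _); rewrite wtT subrr !mulr0 expR0; lra.
by rewrite pmulr_lle0 ?expR_gt0 // subr_le0 /wt (leNgt t T) Tt.
Qed.

(** The unstable component is controlled from its value at [T]. Before [T] the barrier is applied to
    [- u], and [th <= lam / 2] gives [(lam - th) / 4 >= lam / 8 >= eps]; after [T] the inequality
    [L <= (nu - lam) / 4] takes over. *)
Lemma unstable_ub (th t1 B : R) (u b : R -> R) : T <= t1 -> 0 <= th <= lam / 2 ->
  0 <= B -> u T = 0 ->
  (forall t, t <= t1 -> is_derive t 1 u (lam * u t + b t)) ->
  (forall t, t <= t1 -> `|b t| <= lip t * (B * wt th t)) ->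
  forall t, t <= t1 -> u t <= B / 4 * wt th t.
Proof.
have [[l0 m0 e0] [el em eL Ln]] := consts.
move=> Tt1 /andP[th0 thl] B0 uT du bB t tt1; have [tT|Tt] := leP t T.
  have := @barrier R (fun r => - u r) (fun r => - b r) lam (- (B / 4)) th T t T tT => H.
  have {H} : 0 <= (- u t - - (B / 4) * expR (th * (t - T))) * expR (- lam * (t - T)).
    apply: le_trans (H _ _).
    - by rewrite uT subrr !mulr0 expR0; lra.
    - move=> r /andP[_ rt]; have h : is_derive r 1 u (lam * u r + b r).
        by apply: du; lra.
      by apply: is_derive_eq; ring.
    - move=> r /andP[_ rT].
      apply: le_trans (_ : `|b r| <= _); first by rewrite -normrN ler_norm.
      apply: le_trans (bB r _) _; first lra.
      rewrite /lip /wt rT; set x := expR _.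
      have x0 : 0 < x := expR_gt0 _.
      have Bx : 0 <= B * x by rewrite mulr_ge0 // ltW.
      have -> : - (B / 4) * (th - lam) * x = (lam - th) / 4 * (B * x) by field.
      by apply: ler_wpM2r => //; lra.
  rewrite pmulr_lge0 ?expR_gt0 // /wt tT; lra.
have := @barrier R u b lam (B / 4) nu T T t (ltW Tt) => H.
have {H} : (u t - B / 4 * expR (nu * (t - T))) * expR (- lam * (t - T)) <= 0.
  apply: le_trans (H _ _) _.
  - by move=> r /andP[_ rt]; apply: du; lra.
  - move=> r /andP[Tr rt].
    apply: le_trans (ler_norm _) _.
    apply: le_trans (bB r _) _; first lra.
    have lr : lip r <= L by rewrite /lip; case: ifP.
    have -> : wt th r = expR (nu * (r - T)).
      rewrite /wt; case: ifP => // rT.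
      by have -> : r = T; [apply/eqP; rewrite eq_le rT|rewrite subrr !mulr0].
    set x := expR _; have x0 : 0 < x := expR_gt0 _.
    have Bx : 0 <= B * x by rewrite mulr_ge0 // ltW.
    have -> : B / 4 * (nu - lam) * x = (nu - lam) / 4 * (B * x) by field.
    by apply: ler_wpM2r => //; lra.
  - by rewrite uT subrr !mulr0 expR0; lra.
by rewrite pmulr_lle0 ?expR_gt0 // subr_le0 /wt (leNgt t T) Tt.
Qed.

Lemma stable_bound (th t1 C B : R) (v b : R -> R) : T <= t1 -> 0 <= th ->
  (forall t, t <= t1 -> is_derive t 1 v (- mu * v t + b t)) ->
  (forall t, t <= T -> `|v t| <= C) ->
  (forall t, t <= t1 -> `|b t| <= lip t * (B * wt th t)) ->
  forall t, t <= t1 -> `|v t| <= B / 4 * wt th t.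
Proof.
have [[l0 m0 e0] [el em eL Ln]] := consts.
move=> Tt1 th0 dv vC bB t tt1.
have B0 : 0 <= B.
  have := le_trans (normr_ge0 _) (bB T Tt1).
  by rewrite pmulr_rge0 ?lip_gt0 // pmulr_lge0 ?wt_gt0.
rewrite ler_norml; apply/andP; split; last first.
  apply: (@stable_ub th t1 C B v b) => // r rt.
    exact: le_trans (ler_norm _) (vC _ rt).
  exact: le_trans (ler_norm _) (bB _ rt).
rewrite lerNl.
apply: (@stable_ub th t1 C B (fun r => - v r) (fun r => - b r)) => // r rt.
- have h := dv r rt; by apply: is_derive_eq; ring.
- by apply: le_trans (vC _ rt); rewrite -normrN ler_norm.
- by apply: le_trans (bB _ rt); rewrite -normrN ler_norm.
Qed.

Lemma unstable_bound (th t1 B : R) (u b : R -> R) : T <= t1 -> 0 <= th <= lam / 2 ->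
  (forall t, t <= t1 -> is_derive t 1 u (lam * u t + b t)) ->
  (forall t, t <= t1 -> `|b t| <= lip t * (B * wt th t)) ->
  forall t, t <= t1 -> `|u t| <= (`|u T| + B / 4) * wt th t.
Proof.
have [[l0 m0 e0] [el em eL Ln]] := consts.
move=> Tt1 th0 du bB t tt1.
have B0 : 0 <= B.
  have := le_trans (normr_ge0 _) (bB T Tt1).
  by rewrite pmulr_rge0 ?lip_gt0 // pmulr_lge0 ?wt_gt0.
(* Subtracting the homogeneous solution reduces to a zero value at [T]. *)
pose u0 r := u r - u T * expR (lam * (r - T)).
have du0 r : r <= t1 -> is_derive r 1 u0 (lam * u0 r + b r).
  move=> rt; have h1 := du r rt; have h2 := is_derive_expRM lam T r.
  by rewrite /u0; apply: is_derive_eq; rewrite /GRing.scale /=; ring.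
have u0T : u0 T = 0 by rewrite /u0 subrr mulr0 expR0 mulr1 subrr.
have e1 : `|u0 t| <= B / 4 * wt th t.
  rewrite ler_norml; apply/andP; split; last exact: (@unstable_ub th t1 B u0 b).
  rewrite lerNl.
  apply: (@unstable_ub th t1 B (fun r => - u0 r) (fun r => - b r)) => //.
  - by rewrite u0T oppr0.
  - move=> r rt; have h := du0 r rt; by apply: is_derive_eq; ring.
  - by move=> r rt; rewrite normrN; exact: bB.
have e2 : expR (lam * (t - T)) <= wt th t.
  rewrite /wt ler_expR; have [tT|Tt] := leP t T.
    by apply: ler_wnM2r; [lra|move/andP: th0 => [? ?]; lra].
  by apply: ler_wpM2r; lra.
have -> : u t = u T * expR (lam * (t - T)) + u0 t by rewrite /u0; ring.
apply: le_trans (ler_normD _ _) _; rewrite normrM (gtr0_norm (expR_gt0 _)) mulrDl.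
by apply: lerD => //; apply: ler_wpM2l.
Qed.

(** The bounds [C] and [D] are only qualitative: a bootstrap on the best constant removes them from
    the conclusion. The statement stops at [t1] because the Taylor estimates used later are uniform
    only up to a finite time. *)
Lemma dichotomy_bound (th t1 E C D : R) (u v b : R -> R) :
  T <= t1 -> 0 <= th <= lam / 2 -> 0 <= E ->
  (forall t, t <= t1 -> is_derive t 1 u (lam * u t + b t)) ->
  (forall t, t <= t1 -> is_derive t 1 v (- mu * v t + b t)) ->
  (forall t, t <= T -> `|v t| <= C) ->
  (forall t, t <= t1 -> `|u t - v t| <= D * wt th t) ->
  (forall t, t <= t1 -> `|b t| <= lip t * (`|u t - v t| + E * wt th t)) ->
  let M := 2 * `|u T| + E in
  forall t, t <= t1 -> [/\ `|u t - v t| <= M * wt th t,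
    `|u t| <= M * wt th t & `|v t| <= M * wt th t].
Proof.
have [[l0 m0 e0] [el em eL Ln]] := consts.
move=> Tt1 thl E0 du dv vC wD bE M.
have step K : (forall t, t <= t1 -> `|u t - v t| <= K * wt th t) ->
    forall t, t <= t1 -> `|u t| <= (`|u T| + (K + E) / 4) * wt th t /\
                         `|v t| <= (K + E) / 4 * wt th t.
  move=> wK.
  have bK t : t <= t1 -> `|b t| <= lip t * ((K + E) * wt th t).
    move=> tt1; apply: le_trans (bE t tt1) _.
    by rewrite ler_wpM2l ?(ltW (lip_gt0 _)) // mulrDl lerD2r wK.
  move=> t tt1; split; first exact: (@unstable_bound th t1 _ u b).
  by move/andP: thl => [? _]; exact: (@stable_bound th t1 C _ v b).
pose A := [set K : R | forall t, t <= t1 -> `|u t - v t| <= K * wt th t].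
have A0 : A !=set0 by exists D.
have lbA : lbound A 0.
  move=> K /(_ T Tt1); rewrite wtT mulr1; exact: le_trans.
have hlbA : has_lbound A by exists 0.
have Ainf : A (inf A).
  move=> t tt1; rewrite -ler_pdivrMr ?wt_gt0 //; apply: lb_le_inf => // K AK.
  by rewrite ler_pdivrMr ?wt_gt0 // AK.
(* The infimum is itself an admissible constant, and [step] turns it into the admissible constant
   [|u T| + (inf A + E) / 2], which cannot be smaller. *)
have infM : inf A <= M.
  suff : inf A <= `|u T| + (inf A + E) / 2 by rewrite /M; lra.
  apply: ge_inf => // t tt1; have [h1 h2] := step _ Ainf t tt1.
  apply: le_trans (ler_normB _ _) _; apply: le_trans (lerD h1 h2) _.
  by rewrite -mulrDl ler_wpM2r ?(ltW (wt_gt0 _ _)) //; lra.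
have AM t : t <= t1 -> `|u t - v t| <= M * wt th t.
  by move=> tt1; apply: le_trans (Ainf t tt1) _; rewrite ler_wpM2r ?(ltW (wt_gt0 _ _)).
move=> t tt1; have [h1 h2] := step _ AM t tt1; split; first exact: AM.
  by apply: le_trans h1 _; rewrite ler_wpM2r ?(ltW (wt_gt0 _ _)) // /M;
    have := normr_ge0 (u T); lra.
by apply: le_trans h2 _; rewrite ler_wpM2r ?(ltW (wt_gt0 _ _)) // /M;
    have := normr_ge0 (u T); lra.
Qed.

End dichotomy.

(** * Linear equations *)

Section antiderivative.
Context {R : realType}.

Let antiderivative_right (b : R -> R) : continuous b ->
  exists B : R -> R, forall t : R, - 1 < t -> is_derive t 1 B (b t).
Proof.
move=> cb; exists (fun x => (\int[lebesgue_measure]_(t in [set` `[- 1, x]]) b t)%R).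
move=> t t1; have tu : t < t + 1 by rewrite ltrDl.
have ib : lebesgue_measure.-integrable `[- 1, t + 1] (EFin \o b).
  apply: continuous_compact_integrable; first exact: segment_compact.
  exact: continuous_subspaceT.
have [h1 h2] := continuous_FTC1_closed tu ib t1 (cb t).
by split; [exact: h1|rewrite -h2 derive1E].
Qed.

Let derive0_const (z : R -> R) (t0 t1 : R) : t0 <= t1 ->
  (forall t, t0 <= t <= t1 -> is_derive t 1 z 0) -> z t0 = z t1.
Proof.
move=> t01 dz; apply/eqP; rewrite eq_le; apply/andP; split.
  exact: (@le_of_derive_ge0 _ z (fun=> 0)).
rewrite -lerN2; apply: (@le_of_derive_ge0 _ (fun r => - z r) (fun=> 0)) => // t ht.
by have h := dz t ht; apply: is_derive_eq; rewrite oppr0.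
Qed.

Lemma is_derive_near_eq (f g : R -> R) (t d : R) :
  {near t, f =1 g} -> is_derive t (1 : R) f d -> is_derive t 1 g d.
Proof.
move=> fg [df dE]; split; first exact: near_eq_derivable fg df.
by rewrite -dE; apply/esym/near_eq_derive.
Qed.

(** Integration from -1 covers the times after -1, and the same construction for the reflected
    function covers the times before 1. On the overlap both differ by a constant, so normalizing
    them at 0 glues them. *)
Lemma antiderivative (b : R -> R) : continuous b ->
  exists B : R -> R, forall t : R, is_derive t 1 B (b t).
Proof.
move=> cb; have [B1 dB1] := antiderivative_right b cb.
have [|B2 dB2] := antiderivative_right (fun t => b (- t)).
  by move=> t; apply: continuous_comp; [exact: oppr_continuous|exact: cb].
pose B3 t := - B2 (- t).
have dB3 (t : R) : t < 1 -> is_derive t 1 B3 (b t).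
  move=> t1; have h : is_derive (- t) 1 B2 (b t).
    by rewrite -[in b t](opprK t); apply: dB2; lra.
  have hN : is_derive t 1 (fun r : R => - r) (- 1) by apply: is_derive_eq.
  have := @is_derive1_comp _ B2 (fun r : R => - r) t _ _ h hN => hc.
  by rewrite /B3; apply: is_derive_eq; ring.
have agree (t : R) : - 1 < t < 1 -> B1 t - B1 0 = B3 t - B3 0.
  move=> /andP[t1 t2]; suff : B1 t - B3 t = B1 0 - B3 0 by lra.
  have d0 (r : R) : - 1 < r < 1 -> is_derive r 1 (fun x => B1 x - B3 x) 0.
    move=> /andP[r1 r2]; have h1 := dB1 r r1; have h3 := dB3 r r2.
    by apply: is_derive_eq; rewrite subrr.
  have [t0|t0] := leP t 0.
    apply: (derive0_const (fun x => B1 x - B3 x) _ _ t0) => r /andP[? ?].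
    by apply: d0; apply/andP; split; lra.
  apply/esym/(derive0_const (fun x => B1 x - B3 x) _ _ (ltW t0)) => r /andP[? ?].
  by apply: d0; apply/andP; split; lra.
pose B t := if - 1 < t then B1 t - B1 0 else B3 t - B3 0.
exists B => t; have [t1|t1] := ltP t 1.
- apply: (@is_derive_near_eq (fun x => B3 x - B3 0)).
    near=> x; rewrite /B; case: ifP => // x1; apply/esym/agree; rewrite x1 /=.
    by near: x; exact: lt_nbhsl.
  by have h := dB3 t t1; apply: is_derive_eq; rewrite subr0.
- apply: (@is_derive_near_eq (fun x => B1 x - B1 0)).
    near=> x; rewrite /B ifT //.
    by near: x; apply: lt_nbhsr; lra.
  have h : is_derive t 1 B1 (b t) by apply: dB1; lra.
  by apply: is_derive_eq; rewrite subr0.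
Unshelve. all: by end_near. Qed.

End antiderivative.

Section limits.
Context {R : realType}.

Lemma half_expn_lt (c e : R) : 0 < e -> exists n, c / 2 ^+ n < e.
Proof.
move=> e0; pose n := Num.bound `|c / e|; exists n.
rewrite ltr_pdivrMr ?exprn_gt0 // mulrC -ltr_pdivrMr //.
apply: le_lt_trans (ler_norm _) _.
apply: (@lt_le_trans _ _ n%:R); first by rewrite archi_boundP.
by rewrite -natrX ler_nat ltnW // ltn_expl.
Qed.

(** The intervals of radius [c / 2 ^+ n] around [a n] are nested, and the supremum of their left
    ends lies in all of them. *)
Lemma geometric_limit (a : nat -> R) (c : R) :
  (forall n, `|a n.+1 - a n| <= c / 2 ^+ n.+1) ->
  exists l, forall n, `|l - a n| <= c / 2 ^+ n.
Proof.
move=> ha; have c2 n : c / 2 ^+ n = 2 * (c / 2 ^+ n.+1).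
  by rewrite exprS; field; rewrite expf_neq0 ?pnatr_eq0.
have c0 n : 0 <= c / 2 ^+ n by rewrite c2 mulr_ge0 // (le_trans _ (ha n)).
have lo m n : (m <= n)%N -> a m - c / 2 ^+ m <= a n - c / 2 ^+ n.
  elim: n => [|n IH]; first by rewrite leqn0 => /eqP ->.
  rewrite leq_eqVlt => /orP[/eqP -> //|]; rewrite ltnS => /IH h.
  have := ha n; rewrite ler_norml => /andP[h1 _].
  have := c2 n; lra.
have up m n : (m <= n)%N -> a n + c / 2 ^+ n <= a m + c / 2 ^+ m.
  elim: n => [|n IH]; first by rewrite leqn0 => /eqP ->.
  rewrite leq_eqVlt => /orP[/eqP -> //|]; rewrite ltnS => /IH h.
  have := ha n; rewrite ler_norml => /andP[_ h1].
  have := c2 n; lra.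
pose A := [set a n - c / 2 ^+ n | n in [set: nat]].
have ubA n : ubound A (a n + c / 2 ^+ n).
  move=> _ [m _ <-]; have := lo m _ (leq_maxl m n); have := up n _ (leq_maxr m n).
  have := c0 (maxn m n); lra.
exists (sup A) => n; rewrite ler_norml; apply/andP; split.
- have : a n - c / 2 ^+ n <= sup A.
    by apply: ub_le_sup; [exists (a n + c / 2 ^+ n)|exists n].
  lra.
- have : sup A <= a n + c / 2 ^+ n by apply: ge_sup => //; exists (a n - c / 2 ^+ n); exists n.
  lra.
Qed.

Lemma continuous_unif_approx (w : R -> R) (t : R) :
  (forall e : R, 0 < e -> exists2 g : R -> R, {for t, continuous g} &
     \forall r \near t, `|w r - g r| < e) -> {for t, continuous w}.
Proof.
move=> h; apply/cvgrPdist_lt => e e0.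
have e3 : 0 < e / 3 by rewrite divr_gt0.
have [g cg wg] := h _ e3.
have wgt := nbhs_singleton wg.
move/cvgrPdist_lt : cg => /(_ _ e3) cg.
near=> r.
have h1 : `|w r - g r| < e / 3 by near: r.
have h2 : `|g t - g r| < e / 3 by near: r.
move: wgt h1 h2; rewrite !ltr_norml => /andP[? ?] /andP[? ?] /andP[? ?].
by apply/andP; split; lra.
Unshelve. all: by end_near. Qed.

End limits.

Section existence.
Context {R : realType}.
Variables (lam mu nu eps L T : R).
Hypotheses (lam0 : 0 < lam) (mu0 : 0 < mu) (eps0 : 0 < eps)
  (eps_lam : eps <= lam / 8) (eps_mu : eps <= mu / 4) (eps_L : eps <= L)
  (L_nu : L <= (nu - lam) / 4).
Local Notation wt := (wt nu T).
Local Notation lip := (lip eps L T).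

Let consts : [/\ 0 < lam, 0 < mu & 0 < eps] /\
  [/\ eps <= lam / 8, eps <= mu / 4, eps <= L & L <= (nu - lam) / 4].
Proof. by []. Qed.

Lemma wt_le (th t t1 : R) : 0 <= th -> t <= t1 -> T <= t1 ->
  wt th t <= expR (nu * (t1 - T)).
Proof.
have [[l0 m0 e0] [el em eL Ln]] := consts.
move=> th0 tt1 Tt1; rewrite /wt ler_expR; case: ifPn => [tT|].
  apply: (@le_trans _ _ 0); first by rewrite mulr_ge0_le0 //; lra.
  by rewrite mulr_ge0; lra.
by rewrite -ltNge => Tt; rewrite ler_wpM2l; lra.
Qed.

Lemma wt_le1 (th t : R) : 0 <= th -> t <= T -> wt th t <= 1.
Proof.
by move=> th0 tT; have := @wt_le th t T th0 tT (lexx _); rewrite subrr mulr0 expR0.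
Qed.

(** Variation of constants. The free constant of [u] is fixed by the value at [T], that of [v] by
    boundedness at [-oo]: it must be the limit [l] of the antiderivative [B] there. *)
Lemma linear_solution (b : R -> R) (s K : R) : continuous b ->
  (forall t, t <= T -> `|b t| <= K) ->
  exists uv : (R -> R) * (R -> R),
  [/\ forall t : R, is_derive t 1 uv.1 (lam * uv.1 t + b t),
      forall t : R, is_derive t 1 uv.2 (- mu * uv.2 t + b t),
      uv.1 T = s & exists C : R, forall t, t <= T -> `|uv.2 t| <= C].
Proof.
have [[l0 m0 e0] [el em eL Ln]] := consts.
move=> cb bK.
have cbe (m : R) : continuous (fun t => b t * expR (m * (t - T))).
  move=> t; apply: cvgM; first exact: cb.
  exact: is_derive_continuous (is_derive_expRM m T t).
have [A dA] := antiderivative _ (cbe (- lam)); have [B dB] := antiderivative _ (cbe mu).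
pose u t := (A t - A T + s) * expR (lam * (t - T)).
(* Since [|b| <= K] before [T], [al] decreases and [be] increases there. They enclose the limit of
   [B] at [-oo], obtained as a supremum, and their gap yields [|v| <= K / mu]. *)
pose al t := B t - K / mu * expR (mu * (t - T)).
pose be t := B t + K / mu * expR (mu * (t - T)).
have al_le (x y : R) : x <= y -> y <= T -> al y <= al x.
  move=> xy yT; rewrite -lerN2.
  pose dz t := (K - b t) * expR (mu * (t - T)).
  apply: (@le_of_derive_ge0 _ (fun r => - al r) dz) => // t /andP[xt ty].
    have h1 := dB t; have h2 := is_derive_expRM mu T t.
    rewrite /al; apply: is_derive_eq; rewrite /dz /GRing.scale /=.
    by field; exact: lt0r_neq0.
  rewrite /dz mulr_ge0 ?expR_ge0 // subr_ge0; apply: le_trans (ler_norm _) (bK _ _).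
  lra.
have be_le (x y : R) : x <= y -> y <= T -> be x <= be y.
  move=> xy yT.
  pose dz t := (K + b t) * expR (mu * (t - T)).
  apply: (@le_of_derive_ge0 _ be dz) => // t /andP[xt ty].
    have h1 := dB t; have h2 := is_derive_expRM mu T t.
    rewrite /be; apply: is_derive_eq; rewrite /dz /GRing.scale /=.
    by field; exact: lt0r_neq0.
  rewrite /dz mulr_ge0 ?expR_ge0 //.
  have := bK t; rewrite ler_norml => h; have /h/andP[? _] : t <= T by lra.
  lra.
have K0 : 0 <= K by apply: le_trans (bK T (lexx _)).
have al_be t : al t <= be t.
  rewrite /al /be lerD2l; have := expR_ge0 (mu * (t - T)) => ?.
  by rewrite ge0_cp // mulr_ge0 // divr_ge0 // ltW.
pose S := [set al t | t in [set t | t <= T]].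
have ubS t : t <= T -> ubound S (be t).
  move=> tT _ [r /= rT <-]; have [rt|tr] := leP r t.
    exact: le_trans (al_be _) (be_le _ _ rt tT).
  by apply: le_trans (al_be _); apply: al_le => //; exact: ltW.
pose l := sup S.
have l1 t : t <= T -> al t <= l.
  move=> tT; apply: ub_le_sup; last by exists t.
  by exists (be T); exact: ubS.
have l2 t : t <= T -> l <= be t.
  by move=> tT; apply: ge_sup; [exists (al T); exists T => //=|exact: ubS].
pose v t := (B t - l) * expR (- mu * (t - T)).
exists (u, v); split => /=.
- move=> t; have h1 := dA t; have h2 := is_derive_expRM lam T t.
  rewrite /u; apply: is_derive_eq; rewrite /GRing.scale /=.
  have := expRxMexpNx_1 (lam * (t - T)); rewrite -mulNr.
  set x := expR _; set y := expR _ => xy.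
  have -> : lam * ((A t - A T + s) * x) + b t =
    lam * ((A t - A T + s) * x) + b t * (x * y) by rewrite xy mulr1.
  ring.
- move=> t; have h1 := dB t; have h2 := is_derive_expRM (- mu) T t.
  rewrite /v; apply: is_derive_eq; rewrite /GRing.scale /=.
  have := expRxMexpNx_1 (mu * (t - T)); rewrite -mulNr.
  set x := expR _; set y := expR _ => xy.
  have -> : - mu * ((B t - l) * y) + b t =
    - mu * ((B t - l) * y) + b t * (x * y) by rewrite xy mulr1.
  ring.
- by rewrite /u !subrr mulr0 expR0 mulr1 add0r.
- exists (K / mu) => t tT; rewrite /v normrM (gtr0_norm (expR_gt0 _)).
  have := expRxMexpNx_1 (mu * (t - T)); rewrite -mulNr => xy.
  rewrite -[leRHS]mulr1 -xy mulrA ler_wpM2r ?expR_ge0 // ler_norml.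
  by have := l1 t tT; have := l2 t tT; rewrite /al /be => ? ?; apply/andP; split; lra.
Qed.

End existence.

(** * Nonlinear equations *)

Section nonlinear_existence.
Context {R : realType}.
Variables (lam mu nu eps L T : R).
Hypotheses (lam0 : 0 < lam) (mu0 : 0 < mu) (eps0 : 0 < eps)
  (eps_lam : eps <= lam / 8) (eps_mu : eps <= mu / 4) (eps_L : eps <= L)
  (L_nu : L <= (nu - lam) / 4).
Local Notation wt := (wt nu T).
Local Notation lip := (lip eps L T).

Let consts : [/\ 0 < lam, 0 < mu & 0 < eps] /\
  [/\ eps <= lam / 8, eps <= mu / 4, eps <= L & L <= (nu - lam) / 4].
Proof. by []. Qed.

Lemma dichotomy_bound_line (th E C D : R) (u v b : R -> R) :
  0 <= th <= lam / 2 -> 0 <= E ->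
  (forall t : R, is_derive t 1 u (lam * u t + b t)) ->
  (forall t : R, is_derive t 1 v (- mu * v t + b t)) ->
  (forall t, t <= T -> `|v t| <= C) ->
  (forall t, `|u t - v t| <= D * wt th t) ->
  (forall t, `|b t| <= lip t * (`|u t - v t| + E * wt th t)) ->
  forall t, [/\ `|u t - v t| <= (2 * `|u T| + E) * wt th t,
    `|u t| <= (2 * `|u T| + E) * wt th t & `|v t| <= (2 * `|u T| + E) * wt th t].
Proof.
move=> thl E0 du dv vC wD bE t.
apply: (@dichotomy_bound _ lam mu nu eps L T _ _ _ _ _ _ _ th (Num.max t T) E C D u v b) => //.
- by rewrite le_max lexx orbT.
- by rewrite le_max lexx.
Qed.

Variable (G : R -> R -> R).
Hypotheses (G0 : forall t, G 0 t = 0)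
  (Gcont : forall w : R -> R, continuous w -> continuous (fun t => G (w t) t))
  (Glip : forall t w w', `|G w t - G w' t| <= lip t * `|w - w'|).

Definition dichotomic_solution (th s : R) (u v : R -> R) : Prop :=
  [/\ forall t : R, is_derive t 1 u (lam * u t + G (u t - v t) t),
      forall t : R, is_derive t 1 v (- mu * v t + G (u t - v t) t), u T = s
    & forall t, [/\ `|u t - v t| <= 2 * `|s| * wt th t,
        `|u t| <= 2 * `|s| * wt th t & `|v t| <= 2 * `|s| * wt th t]].

(** Picard iteration on the weighted ball of radius [M = 2 * |s|], which is preserved because
    [|s| + M / 4 + M / 4 = M]. Convergence is pointwise with an explicit rate, and continuity of the
    limit follows from local uniformity. *)
Lemma dichotomic_solution_exists (th s : R) : 0 <= th <= lam / 2 ->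
  exists uv : (R -> R) * (R -> R), dichotomic_solution th s uv.1 uv.2.
Proof.
have [[l0 m0 e0] [el em eL Ln]] := consts.
move=> thl; have /andP[th0 _] := thl.
(* The zero pair is a dummy value for forcings outside the linear theory, so that choice yields an
   operator on all functions. *)
have sol_ex (b : R -> R) : exists uv : (R -> R) * (R -> R),
    continuous b -> (exists K : R, forall t, t <= T -> `|b t| <= K) ->
    [/\ forall t : R, is_derive t 1 uv.1 (lam * uv.1 t + b t),
      forall t : R, is_derive t 1 uv.2 (- mu * uv.2 t + b t),
      uv.1 T = s & exists C : R, forall t, t <= T -> `|uv.2 t| <= C].
  have [[cb [K bK]]|h] := pselect (continuous b /\ exists K : R, forall t, t <= T -> `|b t| <= K).
    have [uv huv] := @linear_solution _ lam mu nu eps L T lam0 mu0 eps0 eps_lam eps_mu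
      eps_L L_nu b s K cb bK.
    by exists uv.
  by exists (fun=> 0, fun=> 0) => cb bK; exfalso; apply: h.
have [sol solP] := choice sol_ex.
pose Phi (w : R -> R) : R -> R :=
  fun t => (sol (fun t => G (w t) t)).1 t - (sol (fun t => G (w t) t)).2 t.
pose M := 2 * `|s|.
have M0 : 0 <= M by rewrite mulr_ge0.
have Gbnd w : (forall t, `|w t| <= M * wt th t) ->
    forall t, `|G (w t) t| <= lip t * (M * wt th t).
  move=> wM t; have := Glip t (w t) 0; rewrite G0 !subr0 => /le_trans; apply.
  by rewrite ler_wpM2l // ltW // lip_gt0.
have good w : continuous w -> (forall t, `|w t| <= M * wt th t) ->
    [/\ forall t : R, is_derive t 1 (sol (fun t => G (w t) t)).1
            (lam * (sol (fun t => G (w t) t)).1 t + G (w t) t),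
      forall t : R, is_derive t 1 (sol (fun t => G (w t) t)).2
            (- mu * (sol (fun t => G (w t) t)).2 t + G (w t) t),
      (sol (fun t => G (w t) t)).1 T = s &
      exists C : R, forall t, t <= T -> `|(sol (fun t => G (w t) t)).2 t| <= C].
  move=> cw wM; apply: solP; first exact: Gcont.
  exists (eps * M) => t tT; apply: le_trans (Gbnd w wM t) _.
  rewrite /lip tT ler_wpM2l ?(ltW e0) // ler_piMr //.
  exact: (@wt_le1 _ lam mu nu eps L T).
have Phi_cont w : continuous w -> (forall t, `|w t| <= M * wt th t) ->
    continuous (Phi w).
  move=> cw wM t; have [d1 d2 _ _] := good w cw wM.
  by apply: cvgB; [exact: is_derive_continuous (d1 t)|exact: is_derive_continuous (d2 t)].
have Phi_bound w : continuous w -> (forall t, `|w t| <= M * wt th t) ->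
    forall t, `|Phi w t| <= M * wt th t.
  move=> cw wM t; have [d1 d2 uT [C vC]] := good w cw wM.
  have tm : t <= Num.max t T by rewrite le_max lexx.
  have Tm : T <= Num.max t T by rewrite le_max lexx orbT.
  have h1 := @unstable_bound _ lam mu nu eps L T lam0 mu0 eps0 eps_lam eps_mu eps_L L_nu
    th _ M _ _ Tm thl (fun r _ => d1 r) (fun r _ => Gbnd w wM r) t tm.
  have h2 := @stable_bound _ lam mu nu eps L T lam0 mu0 eps0 eps_lam eps_mu eps_L L_nu
    th _ C M _ _ Tm th0 (fun r _ => d2 r) vC (fun r _ => Gbnd w wM r) t tm.
  apply: le_trans (ler_normB _ _) _; apply: le_trans (lerD h1 h2) _.
  rewrite -mulrDl uT ler_wpM2r ?(ltW (wt_gt0 _ _ _ _)) // /M; have := normr_ge0 s; lra.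
have Phi_contr w w' (c : R) :
    continuous w -> (forall t, `|w t| <= M * wt th t) ->
    continuous w' -> (forall t, `|w' t| <= M * wt th t) ->
    (forall t, `|w t - w' t| <= c * wt th t) ->
    forall t, `|Phi w t - Phi w' t| <= c / 2 * wt th t.
  move=> cw wM cw' w'M wc t; have [d1 d2 uT [C vC]] := good w cw wM.
  have [d1' d2' uT' [C' vC']] := good w' cw' w'M.
  have tm : t <= Num.max t T by rewrite le_max lexx.
  have Tm : T <= Num.max t T by rewrite le_max lexx orbT.
  pose u := (sol (fun t => G (w t) t)).1; pose v := (sol (fun t => G (w t) t)).2.
  pose u' := (sol (fun t => G (w' t) t)).1; pose v' := (sol (fun t => G (w' t) t)).2.
  pose b t := G (w t) t - G (w' t) t.
  have bB r : `|b r| <= lip r * (c * wt th r).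
    by apply: le_trans (Glip _ _ _) _; rewrite ler_wpM2l // ltW // lip_gt0.
  have dU (r : R) : is_derive r 1 (fun x => u x - u' x) (lam * (u r - u' r) + b r).
    by have h := d1 r; have h' := d1' r; apply: is_derive_eq; rewrite /b /u /u'; ring.
  have dV (r : R) : is_derive r 1 (fun x => v x - v' x) (- mu * (v r - v' r) + b r).
    by have h := d2 r; have h' := d2' r; apply: is_derive_eq; rewrite /b /v /v'; ring.
  have h1 := @unstable_bound _ lam mu nu eps L T lam0 mu0 eps0 eps_lam eps_mu eps_L L_nu
    th _ c _ _ Tm thl (fun r _ => dU r) (fun r _ => bB r) t tm.
  have vCC r : r <= T -> `|v r - v' r| <= C + C'.
    by move=> rT; apply: le_trans (ler_normB _ _) _; apply: lerD; [exact: vC|exact: vC'].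
  have h2 := @stable_bound _ lam mu nu eps L T lam0 mu0 eps0 eps_lam eps_mu eps_L L_nu
    th _ _ c _ _ Tm th0 (fun r _ => dV r) vCC (fun r _ => bB r) t tm.
  have -> : Phi w t - Phi w' t = (u t - u' t) - (v t - v' t).
    by rewrite /Phi /u /u' /v /v'; ring.
  apply: le_trans (ler_normB _ _) _; apply: le_trans (lerD h1 h2) _.
  by rewrite -mulrDl /u /u' uT uT' subrr normr0 ler_wpM2r ?(ltW (wt_gt0 _ _ _ _)) //; lra.
pose a n := iter n Phi (fun=> 0).
have aP n : continuous (a n) /\ forall t, `|a n t| <= M * wt th t.
  elim: n => [|n [IH1 IH2]] /=.
    split; first by move=> t; exact: cvg_cst.
    by move=> t; rewrite normr0 mulr_ge0 ?(ltW (wt_gt0 _ _ _ _)).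
  by split; [exact: Phi_cont|exact: Phi_bound].
have adiff n t : `|a n.+1 t - a n t| <= M * wt th t / 2 ^+ n.
  elim: n t => [|n IH] t; first by rewrite expr0 divr1 subr0; exact: (aP 1%N).2.
  have [c1 b1] := aP n.+1; have [c2 b2] := aP n.
  have -> : M * wt th t / 2 ^+ n.+1 = (M / 2 ^+ n) / 2 * wt th t.
    by rewrite exprS; field; rewrite expf_neq0 ?pnatr_eq0.
  apply: Phi_contr => // r; apply: le_trans (IH r) _.
  by rewrite mulrAC.
have lim_ex t : exists l, forall n, `|l - a n t| <= (2 * M * wt th t) / 2 ^+ n.
  apply: geometric_limit => n; apply: le_trans (adiff n t) _.
  rewrite exprS le_eqVlt; apply/orP; left; apply/eqP; field.
  by rewrite expf_neq0 ?pnatr_eq0.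
have [w wE] := choice lim_ex.
have wM t : `|w t| <= M * wt th t.
  apply/ler_addgt0Pr => e e0'.
  have [n hn] := half_expn_lt (2 * M * wt th t) e e0'.
  have -> : w t = a n t + (w t - a n t) by ring.
  apply: le_trans (ler_normD _ _) _; apply: lerD; first exact: (aP n).2.
  by apply: le_trans (wE t n) _; exact: ltW.
have cw : continuous w.
  move=> t; apply: continuous_unif_approx => e e0'.
  (* [W] bounds the weight at all times up to [t + 1], which makes the rate uniform near [t]. *)
  pose W := expR (nu * (`|t| + 1 + `|T| - T)).
  have [n hn] := half_expn_lt (2 * M * W) e e0'.
  exists (a n); first exact: (aP n).1.
  near=> r.
  apply: le_lt_trans (wE r n) _; apply: le_lt_trans hn.
  rewrite ler_wpM2r ?invr_ge0 ?exprn_ge0 // ler_wpM2l ?mulr_ge0 //.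
  apply: (@wt_le _ lam mu nu eps L T) => //.
    have : r < t + 1 by near: r; apply: lt_nbhsl; lra.
    by have := ler_norm t; have := normr_ge0 T; lra.
  by have := ler_norm T; have := normr_ge0 t; lra.
have fixw t : Phi w t = w t.
  apply/eqP; rewrite -subr_eq0 -normr_le0; apply/ler_addgt0Pr => e e0'; rewrite add0r.
  have [n hn] := half_expn_lt (2 * (2 * M * wt th t)) e e0'.
  have h1 : `|Phi w t - a n.+1 t| <= (2 * M / 2 ^+ n) / 2 * wt th t.
    apply: Phi_contr => //; [exact: (aP n).1|exact: (aP n).2|].
    by move=> r; apply: le_trans (wE r n) _; rewrite mulrAC.
  have h2 := wE t n.+1.
  have -> : Phi w t - w t = (Phi w t - a n.+1 t) - (w t - a n.+1 t) by ring.
  apply: le_trans (ler_normB _ _) _; apply: le_trans (lerD h1 h2) _.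
  apply: ltW; apply: le_lt_trans hn.
  have -> : 2 * M / 2 ^+ n / 2 * wt th t + 2 * M * wt th t / 2 ^+ n.+1 =
      2 * (M * wt th t / 2 ^+ n).
    by rewrite exprS; field; rewrite expf_neq0 ?pnatr_eq0.
  have -> : 2 * (2 * M * wt th t) / 2 ^+ n = 4 * (M * wt th t / 2 ^+ n).
    by field; rewrite expf_neq0 ?pnatr_eq0.
  by rewrite ler_wpM2r ?ler_nat // !mulr_ge0 ?invr_ge0 ?exprn_ge0 // ltW // wt_gt0.
have [d1 d2 uT [C vC]] := good w cw wM.
exists (sol (fun t => G (w t) t)).
set u := (sol _).1 in d1 uT *; set v := (sol _).2 in d2 vC *.
have wuv t : w t = u t - v t by rewrite -fixw.
split => //.
- by move=> t; rewrite -wuv.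
- by move=> t; rewrite -wuv.
(* The contraction bounds only [u - v]; the dichotomy estimate with [E = 0] bounds [u] and [v]
   separately by the same constant. *)
rewrite -[2 * `|s|]addr0 -{1 2 3}uT.
apply: (@dichotomy_bound_line th 0 C M u v (fun t => G (w t) t)) => //.
- by move=> t; rewrite -wuv.
- move=> t; rewrite mul0r addr0 -wuv.
  by have := Glip t (w t) 0; rewrite G0 !subr0.
Unshelve. all: by end_near. Qed.

End nonlinear_existence.

(** * Smooth dependence on the parameter *)

Section epsilon_delta.
Context {R : realType}.

Lemma is_derive_approx (F : R -> R) (s l : R) :
  (forall e : R, 0 < e -> exists2 d : R, 0 < d & forall h, `|h| < d ->
     `|F (s + h) - F s - h * l| <= e * `|h|) -> is_derive s 1 F l.
Proof.
move=> H.
have lim_l : h^-1 *: (F (h *: 1 + s) - F s) @[h --> 0^'] --> l.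
  apply/cvgrPdist_le => e e0; have [d d0 hd] := H e e0.
  near=> h.
  have h0 : h != 0 by near: h; exact: nbhs_dnbhs_neq.
  have hh : `|h| < d by near: h; exact: dnbhs0_lt.
  have := hd h hh; rewrite /GRing.scale /= mulr1 (addrC h).
  have -> : l - h^-1 * (F (s + h) - F s) = - (h^-1 * (F (s + h) - F s - h * l)).
    by field.
  by move=> hd'; rewrite normrN normrM normfV mulrC ler_pdivrMr ?normr_gt0.
by split; [apply/cvg_ex; exists l|exact/cvg_lim].
Unshelve. all: by end_near. Qed.

Lemma continuous_approx (F : R -> R) (s : R) :
  (forall e : R, 0 < e -> exists2 d : R, 0 < d & forall h, `|h| < d ->
     `|F (s + h) - F s| <= e) -> {for s, continuous F}.
Proof.
move=> H; apply/cvgrPdist_le => e e0; have [d d0 hd] := H e e0.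
exists d => //= x /= xd; have := hd (x - s); rewrite distrC => /(_ xd).
by rewrite subrKC distrC.
Qed.

End epsilon_delta.

Section smooth_dependence.
Context {R : realType}.
Variables (lam mu nu eps L T : R).
Hypotheses (lam0 : 0 < lam) (mu0 : 0 < mu) (eps0 : 0 < eps)
  (eps_lam : eps <= lam / 8) (eps_mu : eps <= mu / 4) (eps_L : eps <= L)
  (L_nu : L <= (nu - lam) / 4).
Local Notation wt := (wt nu T).
Local Notation lip := (lip eps L T).

Let consts : [/\ 0 < lam, 0 < mu & 0 < eps] /\
  [/\ eps <= lam / 8, eps <= mu / 4, eps <= L & L <= (nu - lam) / 4].
Proof. by []. Qed.

Variables (G dG : R -> R -> R).
Hypotheses (G0 : forall t, G 0 t = 0)
  (Gcont : forall w : R -> R, continuous w -> continuous (fun t => G (w t) t))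
  (dGcont : forall w : R -> R, continuous w -> continuous (fun t => dG (w t) t))
  (dGlip : forall w t, `|dG w t| <= lip t)
  (dGunif : forall e : R, 0 < e -> exists2 d : R, 0 < d &
     forall w w' t, `|w - w'| < d -> `|dG w t - dG w' t| < e)
  (Gmvt : forall (t m e w w' : R), w <= w' ->
     (forall z, w <= z <= w' -> `|dG z t - m| <= e) ->
     `|G w' t - G w t - m * (w' - w)| <= e * (w' - w)).

Lemma mvt_lip (t w w' : R) : `|G w t - G w' t| <= lip t * `|w - w'|.
Proof.
wlog ww' : w w' / w' <= w => [hw|].
  have [/hw //|/ltW/hw] := leP w' w; by rewrite distrC (distrC w).
have := @Gmvt t 0 (lip t) w' w ww'; rewrite mul0r subr0 (ger0_norm (_ : 0 <= w - w')).
  by apply => z _; rewrite subr0.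
by rewrite subr_ge0.
Qed.

(** [Gmvt] admits any comparison slope [m]: the value 0 gives the Lipschitz bound, the value
    [dG w t] this Taylor remainder. In this form the hypothesis can be checked piecewise for the
    clamped nonlinearity, without differentiating at the clamping level. *)
Lemma mvt_taylor (e : R) : 0 < e -> exists2 d : R, 0 < d & forall w w' t : R, `|w' - w| < d ->
  `|G w' t - G w t - dG w t * (w' - w)| <= e * `|w' - w|.
Proof.
move=> e0; have [d d0 hd] := dGunif _ e0; exists d => // w w' t.
have [ww'|/ltW w'w] := leP w w' => hw.
  rewrite (ger0_norm (_ : 0 <= w' - w)) ?subr_ge0//; apply: Gmvt => // z /andP[z1 z2].
  apply/ltW/hd; apply: le_lt_trans hw; rewrite !ger0_norm; lra.
have -> : G w' t - G w t - dG w t * (w' - w) = - (G w t - G w' t - dG w t * (w - w')).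
  ring.
rewrite normrN (distrC w' w) (ger0_norm (_ : 0 <= w - w')) ?subr_ge0//.
apply: Gmvt => // z /andP[z1 z2].
apply/ltW/hd; apply: le_lt_trans hw; rewrite !ler0_norm; lra.
Qed.

Variable th : R.
Hypothesis thl : 0 <= th <= lam / 2.
Local Notation sol := (dichotomic_solution lam mu nu T).
Variables (u v p q : R -> R -> R).
Hypotheses (uvP : forall s, sol G th s (u s) (v s))
  (pqP : forall s, sol (fun w t => dG (u s t - v s t) t * w) th 1 (p s) (q s)).

Let wbnd (s t : R) : t <= T -> 2 * `|s| * wt th t <= 2 * `|s|.
Proof.
move=> tT; rewrite ler_piMr // ?mulr_ge0 //.
by apply: (@wt_le1 _ lam mu nu eps L T) => //; case/andP: thl.
Qed.

(** A difference of two solutions solves the linear equations with a forcing at most [lip] times its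
    own [u - v], so the dichotomy bound applies with [E = 0]. *)
Let uv_diff s s' t : [/\ `|(u s' t - u s t) - (v s' t - v s t)| <= 2 * `|s' - s| * wt th t,
  `|u s' t - u s t| <= 2 * `|s' - s| * wt th t
  & `|v s' t - v s t| <= 2 * `|s' - s| * wt th t].
Proof.
have [du dv uT B] := uvP s; have [du' dv' uT' B'] := uvP s'.
pose b r := G (u s' r - v s' r) r - G (u s r - v s r) r.
have dU (r : R) : is_derive r 1 (fun x => u s' x - u s x) (lam * (u s' r - u s r) + b r).
  by have h := du r; have h' := du' r; apply: is_derive_eq; rewrite /b; ring.
have dV (r : R) : is_derive r 1 (fun x => v s' x - v s x) (- mu * (v s' r - v s r) + b r).
  by have h := dv r; have h' := dv' r; apply: is_derive_eq; rewrite /b; ring.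
have := @dichotomy_bound_line _ lam mu nu eps L T lam0 mu0 eps0 eps_lam eps_mu eps_L L_nu
  th 0 (2 * `|s'| + 2 * `|s|) (2 * `|s'| + 2 * `|s|) _ _ b thl (lexx _) dU dV.
rewrite uT uT' addr0; apply.
- move=> r rT; apply: le_trans (ler_normB _ _) _; apply: lerD.
    by have [_ _ h] := B' r; exact: le_trans h (wbnd _ _ rT).
  by have [_ _ h] := B r; exact: le_trans h (wbnd _ _ rT).
- move=> r; have -> : u s' r - u s r - (v s' r - v s r) =
    (u s' r - v s' r) - (u s r - v s r) by ring.
  rewrite mulrDl; apply: le_trans (ler_normB _ _) _; apply: lerD.
    by have [] := B' r.
  by have [] := B r.
- move=> r; rewrite mul0r addr0 /b; apply: le_trans (mvt_lip _ _ _) _.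
  by have -> : u s' r - v s' r - (u s r - v s r) = u s' r - u s r - (v s' r - v s r) by ring.
Qed.

Lemma dichotomic_dependence (s s' t : R) :
  [/\ `|(u s' t - v s' t) - (u s t - v s t)| <= 2 * `|s' - s| * wt th t,
  `|u s' t - u s t| <= 2 * `|s' - s| * wt th t
  & `|v s' t - v s t| <= 2 * `|s' - s| * wt th t].
Proof.
have [h1 h2 h3] := uv_diff s s' t; split=> //.
by have <- : u s' t - u s t - (v s' t - v s t) = u s' t - v s' t - (u s t - v s t) by ring.
Qed.

Let unif_close (t d : R) : 0 < d -> exists2 d' : R, 0 < d' & forall s s',
  `|s' - s| < d' -> forall r, r <= Num.max t T ->
  `|(u s' r - v s' r) - (u s r - v s r)| < d.
Proof.
move=> d0; pose W := expR (nu * (Num.max t T - T)).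
have W0 : 0 < W := expR_gt0 _.
exists (d / (2 * W)); first by rewrite divr_gt0 // mulr_gt0.
move=> s s' ss' r rt; have [h _ _] := dichotomic_dependence s s' r.
apply: le_lt_trans h _.
apply: (@le_lt_trans _ _ (2 * `|s' - s| * W)).
  rewrite ler_wpM2l ?mulr_ge0 //; apply: (@wt_le _ lam mu nu eps L T) => //.
    by case/andP: thl.
  by rewrite le_max lexx orbT.
by move: ss'; rewrite ltr_pdivlMr ?mulr_gt0 // mulrCA mulrA.
Qed.

(** The remainder of the first-order expansion vanishes at [T] and solves the linear equations; its
    forcing is [dG] times its own [u - v] plus a Taylor remainder. The dichotomy bound therefore
    leaves only the [E] term. *)
Let derivative_approx (s t e : R) : 0 < e -> exists2 d : R, 0 < d & forall h, `|h| < d ->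
  `|u (s + h) t - u s t - h * p s t| <= e * `|h| /\
  `|v (s + h) t - v s t - h * q s t| <= e * `|h|.
Proof.
move=> e0; have w0 := wt_gt0 nu T th t.
(* Tuned so that [E * wt th t] below is exactly the target [e * |h|]; the factor [eps] is the lower
   bound of [lip]. *)
pose e' := e * eps / (2 * wt th t).
have e'0 : 0 < e' by rewrite divr_gt0 ?mulr_gt0.
have [d1 d10 tay] := mvt_taylor _ e'0.
have [d d0 close] := unif_close t _ d10.
exists d => // h hd.
have [du dv uT B] := uvP s; have [du' dv' uT' B'] := uvP (s + h).
have [dp dq pT Bp] := pqP s.
set s' := s + h in du' dv' uT' B' *.
have s's : s' - s = h by rewrite /s'; ring.
pose b r := G (u s' r - v s' r) r - G (u s r - v s r) r
   - h * (dG (u s r - v s r) r * (p s r - q s r)).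
pose U r := u s' r - u s r - h * p s r; pose V r := v s' r - v s r - h * q s r.
have dU (r : R) : is_derive r 1 U (lam * U r + b r).
  have h1 := du r; have h2 := du' r; have h3 := dp r.
  by rewrite /U; apply: is_derive_eq; rewrite /b /GRing.scale /=; ring.
have dV (r : R) : is_derive r 1 V (- mu * V r + b r).
  have h1 := dv r; have h2 := dv' r; have h3 := dq r.
  by rewrite /V; apply: is_derive_eq; rewrite /b /GRing.scale /=; ring.
pose E := 2 * e' * `|h| / eps.
have E0 : 0 <= E by apply: divr_ge0 (ltW eps0); apply: mulr_ge0 => //; rewrite mulr_ge0 // ltW.
have UT : U T = 0 by rewrite /U uT uT' pT /s'; ring.
have Tm : T <= Num.max t T by rewrite le_max lexx orbT.
have tm : t <= Num.max t T by rewrite le_max lexx.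
have wE r : U r - V r = (u s' r - v s' r) - (u s r - v s r) - h * (p s r - q s r).
  by rewrite /U /V; ring.
have := @dichotomy_bound _ lam mu nu eps L T lam0 mu0 eps0 eps_lam eps_mu eps_L L_nu
  th (Num.max t T) E (2 * `|s'| + 2 * `|s| + `|h| * 2) (2 * `|s'| + 2 * `|s| + `|h| * 2)
  U V b Tm thl E0 (fun r _ => dU r) (fun r _ => dV r) _ _ _ t tm.
rewrite UT normr0 mulr0 add0r /=.
have Ee : E * wt th t = e * `|h|.
  by rewrite /E /e'; field; rewrite !lt0r_neq0.
rewrite Ee => H; have [|||_ h1 h2] := H; last by [].
- move=> r rT; apply: le_trans (ler_normB _ _) _; apply: lerD.
    apply: le_trans (ler_normB _ _) _; apply: lerD.
      by have [_ _ k] := B' r; exact: le_trans k (wbnd _ _ rT).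
    by have [_ _ k] := B r; exact: le_trans k (wbnd _ _ rT).
  rewrite normrM ler_wpM2l //; have [_ _ k] := Bp r; apply: le_trans k _.
  by have := wbnd 1 _ rT; rewrite normr1 mulr1.
- move=> r rt; rewrite wE 2!(mulrDl _ _ (wt th r)); apply: le_trans (ler_normB _ _) _; apply: lerD.
    apply: le_trans (ler_normB _ _) _; apply: lerD; first by have [] := B' r.
    by have [] := B r.
  rewrite normrM -mulrA ler_wpM2l //; have [k _ _] := Bp r.
  by move: k; rewrite normr1 mulr1.
- move=> r rt; rewrite wE.
  set w' := u s' r - v s' r; set w := u s r - v s r; set y := p s r - q s r.
  have -> : b r = (G w' r - G w r - dG w r * (w' - w)) + dG w r * (w' - w - h * y).
    by rewrite /b -/w' -/w -/y; ring.
  apply: le_trans (ler_normD _ _) _; rewrite [leLHS]addrC (mulrDr (lip r)); apply: lerD.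
    by rewrite normrM ler_wpM2r.
  have ww' : `|w' - w| < d1 by apply: close => //; rewrite s's.
  apply: le_trans (tay w w' r ww') _.
  apply: (@le_trans _ _ (eps * (E * wt th r))); last first.
    by rewrite ler_wpM2r ?lip_ge // mulr_ge0 // ltW // wt_gt0.
  have -> : eps * (E * wt th r) = e' * (2 * `|h| * wt th r).
    by rewrite /E; field; rewrite lt0r_neq0.
  rewrite ler_pM2l //; have [k _ _] := dichotomic_dependence s s' r.
  by rewrite -s's.
Qed.

Lemma dichotomic_derive (s t : R) :
  is_derive s 1 (fun x => u x t) (p s t) /\ is_derive s 1 (fun x => v x t) (q s t).
Proof.
split; apply: is_derive_approx => e e0; have [d d0 hd] := derivative_approx s t _ e0;
  exists d => // h /hd; by case.
Qed.

(** Same scheme for two variational solutions: both equal 1 at [T], and the extra forcing is the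
    variation of [dG] times a solution of known size. *)
Let continuity_approx (s t e : R) : 0 < e -> exists2 d : R, 0 < d & forall h, `|h| < d ->
  `|p (s + h) t - p s t| <= e /\ `|q (s + h) t - q s t| <= e.
Proof.
move=> e0; have w0 := wt_gt0 nu T th t.
pose e' := e * eps / (2 * wt th t).
have e'0 : 0 < e' by rewrite divr_gt0 ?mulr_gt0.
have [d1 d10 uni] := dGunif _ e'0.
have [d d0 close] := unif_close t _ d10.
exists d => // h hd.
have [dp dq pT B] := pqP s; have [dp' dq' pT' B'] := pqP (s + h).
set s' := s + h in dp' dq' pT' B' *.
have s's : s' - s = h by rewrite /s'; ring.
pose b r := dG (u s' r - v s' r) r * (p s' r - q s' r)
   - dG (u s r - v s r) r * (p s r - q s r).
pose U r := p s' r - p s r; pose V r := q s' r - q s r.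
have dU (r : R) : is_derive r 1 U (lam * U r + b r).
  have h1 := dp r; have h2 := dp' r.
  by rewrite /U; apply: is_derive_eq; rewrite /b; ring.
have dV (r : R) : is_derive r 1 V (- mu * V r + b r).
  have h1 := dq r; have h2 := dq' r.
  by rewrite /V; apply: is_derive_eq; rewrite /b; ring.
pose E := 2 * e' / eps.
have E0 : 0 <= E by apply: divr_ge0 (ltW eps0); rewrite mulr_ge0 // ltW.
have UT : U T = 0 by rewrite /U pT pT' subrr.
have Tm : T <= Num.max t T by rewrite le_max lexx orbT.
have tm : t <= Num.max t T by rewrite le_max lexx.
have wE r : U r - V r = (p s' r - q s' r) - (p s r - q s r).
  by rewrite /U /V; ring.
have := @dichotomy_bound _ lam mu nu eps L T lam0 mu0 eps0 eps_lam eps_mu eps_L L_nu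
  th (Num.max t T) E (2 + 2) (2 + 2)
  U V b Tm thl E0 (fun r _ => dU r) (fun r _ => dV r) _ _ _ t tm.
rewrite UT normr0 mulr0 add0r /=.
have Ee : E * wt th t = e.
  by rewrite /E /e'; field; rewrite !lt0r_neq0.
have B1 s1 r : [/\ `|p s1 r - q s1 r| <= 2 * wt th r & r <= T -> `|q s1 r| <= 2].
  have [_ _ _ k] := pqP s1; have [k1 _ k2] := k r; move: k1 k2.
  rewrite normr1 mulr1 => k1 k2; split=> // rT; apply: le_trans k2 _.
  by have := wbnd 1 _ rT; rewrite normr1 mulr1.
rewrite Ee => H; have [|||_ h1 h2] := H; last by [].
- move=> r rT; apply: le_trans (ler_normB _ _) _; apply: lerD.
    by have [_] := B1 s' r; apply.
  by have [_] := B1 s r; apply.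
- move=> r rt; rewrite wE mulrDl; apply: le_trans (ler_normB _ _) _; apply: lerD.
    by have [] := B1 s' r.
  by have [] := B1 s r.
- move=> r rt; rewrite wE.
  set w' := u s' r - v s' r; set w := u s r - v s r.
  set y' := p s' r - q s' r; set y := p s r - q s r.
  have -> : b r = (dG w' r - dG w r) * y' + dG w r * (y' - y).
    by rewrite /b -/w' -/w -/y' -/y; ring.
  apply: le_trans (ler_normD _ _) _; rewrite [leLHS]addrC (mulrDr (lip r)); apply: lerD.
    by rewrite normrM ler_wpM2r.
  have ww' : `|w' - w| < d1 by apply: close => //; rewrite s's.
  apply: (@le_trans _ _ (eps * (E * wt th r))); last first.
    by rewrite ler_wpM2r ?lip_ge // mulr_ge0 // ltW // wt_gt0.
  have -> : eps * (E * wt th r) = e' * (2 * wt th r).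
    by rewrite /E; field; rewrite lt0r_neq0.
  rewrite normrM; apply: ler_pM => //; first by apply/ltW/uni.
  by have [] := B1 s' r.
Qed.

Lemma dichotomic_derive_continuous (s t : R) :
  {for s, continuous (fun x => p x t)} /\ {for s, continuous (fun x => q x t)}.
Proof.
split; apply: continuous_approx => e e0; have [d d0 hd] := continuity_approx s t _ e0;
  exists d => // h /hd; by case.
Qed.

End smooth_dependence.

(** * Backward uniqueness for the diagonal system *)

Section backward_uniqueness.
Context {R : realType}.

(** The energy [u ^+ 2 + v ^+ 2] times [expR (C * t)] is nondecreasing: [2 * mu] compensates the
    decay of [v], and [4 * |K|] absorbs the forcing through [(|u| + |v|) ^+ 2 <= 2 * (u ^+ 2 + v ^+
    2)]. Vanishing at the later time thus forces vanishing before. *)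
Lemma backward_zero (lam mu K t0 t1 : R) (u v b : R -> R) :
  0 <= lam -> 0 <= mu -> t0 <= t1 ->
  (forall t, t0 <= t <= t1 -> is_derive t 1 u (lam * u t + b t)) ->
  (forall t, t0 <= t <= t1 -> is_derive t 1 v (- mu * v t + b t)) ->
  (forall t, t0 <= t <= t1 -> `|b t| <= K * `|u t - v t|) ->
  u t1 = 0 -> v t1 = 0 -> u t0 = 0 /\ v t0 = 0.
Proof.
move=> lam0 mu0 t01 du dv bK u1 v1.
pose C := 2 * mu + 4 * `|K|.
pose z t := (u t * u t + v t * v t) * expR (C * (t - 0)).
pose dz t := (2 * u t * (lam * u t + b t) + 2 * v t * (- mu * v t + b t)
   + C * (u t * u t + v t * v t)) * expR (C * (t - 0)).
have : z t0 <= z t1.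
  apply: (@le_of_derive_ge0 _ z dz) => // t ht.
    have h1 := du t ht; have h2 := dv t ht; have h3 := is_derive_expRM C 0 t.
    by rewrite /z; apply: is_derive_eq; rewrite /dz /GRing.scale /=; ring.
  rewrite /dz mulr_ge0 ?expR_ge0 // /C.
  have kb : `|b t| <= `|K| * (`|u t| + `|v t|).
    apply: le_trans (bK t ht) _; apply: le_trans (ler_norm _) _.
    by rewrite normrM normr_id ler_wpM2l // ler_normB.
  have uu : u t * u t = `|u t| * `|u t| by rewrite -normrM ger0_norm // -expr2 sqr_ge0.
  have vv : v t * v t = `|v t| * `|v t| by rewrite -normrM ger0_norm // -expr2 sqr_ge0.
  have ub : - (`|u t| * `|b t|) <= u t * b t by rewrite -normrM lerNl -normrN ler_norm.
  have vb : - (`|v t| * `|b t|) <= v t * b t by rewrite -normrM lerNl -normrN ler_norm.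
  have a0 := normr_ge0 (u t); have b0 := normr_ge0 (v t); have k0 := normr_ge0 K.
  set a := `|u t| in kb uu ub a0; set c := `|v t| in kb vv vb b0.
  have h1 : (a + c) * `|b t| <= (a + c) * (`|K| * (a + c)) by rewrite ler_wpM2l // addr_ge0.
  have h2 : 0 <= `|K| * ((a - c) * (a - c)) by rewrite mulr_ge0 // -expr2 sqr_ge0.
  have h3 : 0 <= lam * (u t * u t) by rewrite mulr_ge0 // -expr2 sqr_ge0.
  have h4 : 0 <= mu * (u t * u t) by rewrite mulr_ge0 // -expr2 sqr_ge0.
  have -> : 2 * u t * (lam * u t + b t) + 2 * v t * (- mu * v t + b t) +
    (2 * mu + 4 * `|K|) * (u t * u t + v t * v t) =
    2 * (lam * (u t * u t)) + 2 * (mu * (u t * u t)) + 2 * (u t * b t + v t * b t)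
     + 4 * `|K| * (u t * u t + v t * v t) by ring.
  have h5 : 4 * `|K| * (u t * u t + v t * v t) - 2 * ((a + c) * (`|K| * (a + c)))
     = 2 * (`|K| * ((a - c) * (a - c))) by rewrite uu vv; ring.
  lra.
rewrite /z u1 v1 mulr0 addr0 mul0r pmulr_lle0 ?expR_gt0 // => h.
have u0 : 0 <= u t0 * u t0 by rewrite -expr2 sqr_ge0.
have v0 : 0 <= v t0 * v t0 by rewrite -expr2 sqr_ge0.
by split; apply/eqP; rewrite -[_ == 0]orbb -mulf_eq0; apply/eqP; lra.
Qed.

End backward_uniqueness.

(** * Clamped nonlinearities *)

Definition equicontinuous_on_bounded {R : realType} (k : R -> R -> R) : Prop :=
  forall tau K e : R, 0 < e -> exists2 d : R, 0 < d &
    forall w w' t : R, `|w| <= K -> `|w'| <= K -> t <= tau -> `|w - w'| < d ->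
      `|k w t - k w' t| < e.

(** The increment is split at [k (w t) (r x)]: continuity in time handles the first part,
    equicontinuity in [w] the second. *)
Lemma continuous_along {R : realType} (k : R -> R -> R) (w r : R -> R) (t : R) :
  equicontinuous_on_bounded k -> (forall x, continuous (k x)) ->
  {for t, continuous w} -> {for t, continuous r} ->
  {for t, continuous (fun x => k (w x) (r x))}.
Proof.
move=> ek ck cw cr; apply/cvgrPdist_lt => e e0.
have e2 : 0 < e / 2 by rewrite divr_gt0.
have [d d0 hd] := ek (r t + 1) (`|w t| + 1) _ e2.
have ckr : {for t, continuous (k (w t) \o r)}.
  by apply: continuous_comp => //; exact: ck.
move/cvgrPdist_lt : (cw) => /(_ _ d0) w1.
move/cvgrPdist_lt : (cw) => /(_ _ ltr01) w2.
move/cvgrPdist_lt : (cr) => /(_ _ ltr01) r1.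
move/cvgrPdist_lt : (ckr) => /(_ _ e2) k1.
near=> x.
have h1 : `|w t - w x| < d by near: x.
have h2 : `|w t - w x| < 1 by near: x.
have h3 : `|r t - r x| < 1 by near: x.
have h4 : `|k (w t) (r t) - k (w t) (r x)| < e / 2 by near: x.
have wt1 : `|w t| <= `|w t| + 1 by rewrite lerDl.
have wx1 : `|w x| <= `|w t| + 1.
  have -> : w x = w t - (w t - w x) by ring.
  by apply: le_trans (ler_normB _ _) _; rewrite lerD2l ltW.
have rx : r x <= r t + 1.
  by move: h3; rewrite ltr_norml => /andP[? _]; lra.
have h5 := hd _ _ _ wt1 wx1 rx h1.
have -> : k (w t) (r t) - k (w x) (r x) = (k (w t) (r t) - k (w t) (r x)) +
  (k (w t) (r x) - k (w x) (r x)) by ring.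
by apply: le_lt_trans (ler_normD _ _) _; lra.
Unshelve. all: by end_near. Qed.

Section nonlinearity.
Context {R : realType}.
Variables (F dF : R -> R -> R).

Definition admissible : Prop :=
  [/\ forall t, F 0 t = 0, forall w t : R, is_derive w 1 (fun z => F z t) (dF w t)
    & forall w, continuous (F w)] /\
  (equicontinuous_on_bounded dF /\
   forall e : R, 0 < e -> exists T, forall t, t <= T -> `|dF 0 t| <= e).

Hypothesis Fadm : admissible.

Let FdF (w t : R) : is_derive w 1 (fun z => F z t) (dF w t).
Proof. by case: Fadm => -[]. Qed.

Lemma admissible_mvt (t m e w w' : R) : w <= w' ->
  (forall z, w <= z <= w' -> `|dF z t - m| <= e) ->
  `|F w' t - F w t - m * (w' - w)| <= e * (w' - w).
Proof.
move=> ww' h.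
have [c cw ->] : exists2 c, c \in `[w, w'] & F w' t - F w t = dF c t * (w' - w).
  apply: (@MVT_segment _ (fun z => F z t) (fun z => dF z t)) => //.
  by apply/continuous_in_subspaceT => x _; exact: is_derive_continuous (FdF x t).
rewrite -mulrBl normrM (ger0_norm (_ : 0 <= w' - w)) ?subr_ge0//.
by rewrite ler_wpM2r ?subr_ge0// h//; rewrite in_itv in cw.
Qed.

(** Continuity of [dF] in time is not assumed. It is a locally uniform limit of difference quotients
    with a fixed step, each continuous in time. *)
Lemma admissible_derive_continuous (w : R) : continuous (dF w).
Proof.
move=> t; apply: continuous_unif_approx => e e0.
have [[_ _ Fc] [eF _]] := Fadm.
have e2 : 0 < e / 2 by rewrite divr_gt0.
have [d d0 hd] := eF (t + 1) (`|w| + 1) _ e2.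
(* Below [d] for the equicontinuity, and at most 1 so that [w + x] stays in the ball of radius
   [|w| + 1]. *)
pose x := Num.min (d / 2) 1.
have x0 : 0 < x by rewrite lt_min ltr01 divr_gt0.
have xd : x < d by apply: (@le_lt_trans _ _ (d / 2)); [rewrite ge_min lexx|lra].
have x1 : x <= 1 by rewrite ge_min lexx orbT.
exists (fun r => (F (w + x) r - F w r) / x).
  by apply: cvgM; [apply: cvgB; exact: Fc|exact: cvg_cst].
near=> r.
have rt : r <= t + 1.
  by near: r; apply: filterS (@lt_nbhsl _ t (t + 1) _) => [y /ltW|]; rewrite ?ltrDl.
have wx : w <= w + x by rewrite lerDl ltW.
have := @admissible_mvt r (dF w r) (e / 2) w (w + x) wx.
have -> : w + x - w = x by ring.
move=> H; have {H} : `|F (w + x) r - F w r - dF w r * x| <= e / 2 * x.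
  apply: H => z /andP[z1 z2].
  apply/ltW/hd => //.
  - have -> : z = w + (z - w) by ring.
    apply: le_trans (ler_normD _ _) _; rewrite lerD2l ger0_norm; lra.
  - by rewrite lerDl.
  - by rewrite ger0_norm; lra.
move=> H; apply: (@le_lt_trans _ _ (e / 2)); last lra.
have -> : dF w r - (F (w + x) r - F w r) / x = - ((F (w + x) r - F w r - dF w r * x) / x).
  by field; rewrite lt0r_neq0.
by rewrite normrN normrM normfV (gtr0_norm x0) ler_pdivrMr.
Unshelve. all: by end_near. Qed.

(** At [w = 0] the bound combines smallness near [-oo] with compactness of the remaining time
    interval. It then spreads to [|w| <= K] in [n] steps of length less than [d], each costing at
    most 1. *)
Lemma admissible_derive_bounded (tau K : R) :
  exists M, forall w t : R, `|w| <= K -> t <= tau -> `|dF w t| <= M.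
Proof.
have [_ [eF dF0]] := Fadm.
have [T hT] := dF0 1 ltr01.
have [c _ hc] : exists2 c, c \in `[Num.min T tau, tau] &
    forall t, t \in `[Num.min T tau, tau] -> `|dF 0 t| <= `|dF 0 c|.
  apply: (@EVT_max _ (fun t => `|dF 0 t|)); first by rewrite ge_min lexx orbT.
  apply/continuous_in_subspaceT => x _.
  by apply: cvg_norm; exact: admissible_derive_continuous.
pose M0 := 1 + `|dF 0 c|.
have h0 t : t <= tau -> `|dF 0 t| <= M0.
  move=> tt; have [tT|Tt] := leP t T.
    by apply: le_trans (hT t tT) _; rewrite lerDl.
  apply: le_trans (hc t _) _; last by rewrite lerDr.
  by rewrite in_itv /= tt andbT ge_min ltW.
have [d d0 hd] := eF tau K _ ltr01.
pose n := (Num.bound `|K / d|).+1.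
have n0 : 0 < n%:R :> R by rewrite ltr0n.
have Kn : K / n%:R < d.
  rewrite ltr_pdivrMr // mulrC -ltr_pdivrMr //.
  apply: le_lt_trans (ler_norm _) _; apply: lt_trans (archi_boundP _) _ => //.
  by rewrite ltr_nat.
exists (M0 + n%:R) => w t wK tt.
have step i : (i <= n)%N -> `|dF (w * (i%:R / n%:R)) t| <= M0 + i%:R.
  elim: i => [_|i IH iN]; first by rewrite mul0r mulr0 addr0; exact: h0.
  have wi j : (j <= n)%N -> `|w * (j%:R / n%:R)| <= K.
    move=> jn; rewrite normrM; apply: le_trans wK; rewrite ler_piMr //.
    by rewrite ger0_norm ?divr_ge0 // ler_pdivrMr // mul1r ler_nat.
  have : `|dF (w * (i.+1%:R / n%:R)) t - dF (w * (i%:R / n%:R)) t| < 1.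
    apply: hd => //; [exact: wi|exact/wi/ltnW|].
    have -> : w * (i.+1%:R / n%:R) - w * (i%:R / n%:R) = w / n%:R.
      by rewrite -mulrBr -mulrBl -natrB // subSnn mul1r.
    rewrite normrM normfV (gtr0_norm n0); apply: le_lt_trans Kn.
    by rewrite ler_wpM2r // invr_ge0 ltW.
  have := IH (ltnW iN); rewrite -natr1.
  set A := dF _ _; set B := dF _ _ => h1 h2.
  have -> : B = A + (B - A) by ring.
  by apply: le_trans (ler_normD _ _) _; lra.
by have := step n (leqnn n); rewrite divff ?mulr1 // lt0r_neq0.
Qed.

Lemma admissible_derive_small (e : R) : 0 < e -> exists T rho, 0 < rho /\
  forall w t : R, `|w| <= rho -> t <= T -> `|dF w t| <= e.
Proof.
move=> e0; have [_ [eF dF0]] := Fadm.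
have e2 : 0 < e / 2 by rewrite divr_gt0.
have [T hT] := dF0 _ e2; have [d d0 hd] := eF T 1 _ e2.
exists T, (Num.min (d / 2) 1); split; first by rewrite lt_min ltr01 divr_gt0.
move=> w t; rewrite le_min => /andP[wd w1] tT.
have -> : dF w t = (dF w t - dF 0 t) + dF 0 t by ring.
apply: le_trans (ler_normD _ _) _.
have h1 : `|dF w t - dF 0 t| < e / 2.
  by apply: hd => //; rewrite ?normr0 // subr0; lra.
by have := hT t tT; lra.
Qed.

Lemma admissible_lipschitz (tau K : R) : exists M, forall w w' t : R,
  `|w| <= K -> `|w'| <= K -> t <= tau -> `|F w t - F w' t| <= M * `|w - w'|.
Proof.
have [M hM] := admissible_derive_bounded tau K; exists M => w w' t.
wlog : w w' / w' <= w => [H wK wK' tt|ww' wK wK' tt].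
  have [ww'|/ltW ww'] := leP w' w; first exact: H.
  by rewrite distrC (distrC w); apply: H.
have := @admissible_mvt t 0 M w' w ww'; rewrite mul0r subr0 (ger0_norm (_ : 0 <= w - w')).
  apply => z /andP[z1 z2]; rewrite subr0; apply: hM => //.
  move: wK wK'; rewrite !ler_norml => /andP[? ?] /andP[? ?].
  by apply/andP; split; lra.
by rewrite subr_ge0.
Qed.

Lemma admissible_equicontinuous : equicontinuous_on_bounded F.
Proof.
move=> tau K e e0; have [M hM] := admissible_lipschitz tau K.
have M1 : 0 < `|M| + 1 by have := normr_ge0 M; lra.
exists (e / (`|M| + 1)); first by rewrite divr_gt0.
move=> w w' t wK wK' tt; rewrite ltr_pdivlMr // => h.
apply: le_lt_trans (hM _ _ _ wK wK' tt) _; apply: le_lt_trans h.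
rewrite mulrC ler_wpM2l //; have := ler_norm M; lra.
Qed.

End nonlinearity.

Section clamping.
Context {R : realType}.

Definition clamp (a w : R) : R := Num.max (- a) (Num.min a w).

Variant clamp_spec (a w : R) : R -> Prop :=
  | ClampLow of w < - a : clamp_spec a w (- a)
  | ClampMid of - a <= w <= a : clamp_spec a w w
  | ClampHigh of a < w : clamp_spec a w a.

Lemma clampP (a w : R) : 0 <= a -> clamp_spec a w (clamp a w).
Proof.
move=> a0; rewrite /clamp; have [wa|wa] := leP w (- a).
  have aw : w <= a by lra.
  rewrite (min_idPr aw) (max_idPl wa).
  move: wa; rewrite le_eqVlt => /orP[/eqP wE|]; last exact: ClampLow.
  by rewrite -wE; apply: ClampMid; apply/andP; split; lra.
have [aw|aw] := leP a w.
  have -> : Num.max (- a) a = a by apply/max_idPr; lra.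
  move: aw; rewrite le_eqVlt => /orP[/eqP wE|]; last exact: ClampHigh.
  by rewrite wE; apply: ClampMid; apply/andP; split; lra.
rewrite (max_idPr (ltW wa)); apply: ClampMid; apply/andP; split; lra.
Qed.

Lemma clamp_id (a w : R) : `|w| <= a -> clamp a w = w.
Proof.
rewrite ler_norml => /andP[h1 h2]; have a0 : 0 <= a by lra.
by case: clampP => // h; lra.
Qed.

Lemma clamp_bound (a w : R) : 0 <= a -> `|clamp a w| <= a.
Proof.
by move=> a0; rewrite ler_norml; case: clampP => // h; apply/andP; split; lra.
Qed.

Lemma clamp_nonexpansive (a w w' : R) : 0 <= a ->
  `|clamp a w - clamp a w'| <= `|w - w'|.
Proof.
move=> a0; wlog ww' : w w' / w' <= w.
  move=> H; have [|/ltW] := leP w' w; first exact: H.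
  by rewrite distrC (distrC w); exact: H.
rewrite !ger0_norm; [|lra|].
  by case: (clampP a w a0) => h; case: (clampP a w' a0) => h'; lra.
by case: (clampP a w a0) => h; case: (clampP a w' a0) => h'; lra.
Qed.

Variables (F dF : R -> R -> R).
Hypothesis Fadm : admissible F dF.
Variables (T rho slope t1 : R).
Hypotheses (rho0 : 0 < rho) (slope0 : 0 <= slope) (Tt1 : T <= t1).

Definition level (t : R) : R := rho + slope * Num.max 0 (t - T).
Definition stop (t : R) : R := Num.min t t1.

(* Beyond the level [|w| = level t] the nonlinearity is continued affinely in
   [w], and its time dependence is frozen after [t1]. *)
Definition clamped_dF (w t : R) : R := dF (clamp (level (stop t)) w) (stop t).
Definition clamped_F (w t : R) : R :=
  F (clamp (level (stop t)) w) (stop t)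
  + clamped_dF w t * (w - clamp (level (stop t)) w).

Lemma level_gt0 t : 0 < level t.
Proof. by rewrite ltr_wpDr // mulr_ge0 // le_max lexx. Qed.
Let level_ge0 t : 0 <= level t. Proof. exact/ltW/level_gt0. Qed.

Lemma level_ge t : rho <= level t.
Proof. by rewrite lerDl mulr_ge0 // le_max lexx. Qed.

Lemma level_early t : t <= T -> level t = rho.
Proof.
move=> tT; rewrite /level (max_idPl _) ?mulr0 ?addr0 //; lra.
Qed.

Lemma level_le t : t <= t1 -> level t <= level t1.
Proof.
move=> tt; rewrite lerD2l ler_wpM2l // ge_max !le_max lexx /=.
by apply/orP; right; lra.
Qed.

Lemma level_continuous : continuous level.
Proof.
move=> t; apply: cvgD; first exact: cvg_cst.
apply: cvgM; first exact: cvg_cst.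
apply: (@continuous_max _ _ (fun=> 0) (fun x => x - T)); first exact: cvg_cst.
by apply: cvgB; [exact: cvg_id|exact: cvg_cst].
Qed.

Lemma stop_le t : stop t <= t1. Proof. by rewrite /stop ge_min lexx orbT. Qed.
Lemma stop_id t : t <= t1 -> stop t = t. Proof. by move=> h; rewrite /stop (min_idPl _). Qed.

Lemma stop_continuous : continuous stop.
Proof.
move=> t; apply: (@continuous_min _ _ (fun x => x) (fun=> t1)); first exact: cvg_id.
exact: cvg_cst.
Qed.

Lemma clamped_F0 t : clamped_F 0 t = 0.
Proof.
rewrite /clamped_F clamp_id ?normr0 // subrr mulr0 addr0.
by case: Fadm => -[].
Qed.

Lemma clamped_FE w t : t <= t1 -> `|w| <= level t -> clamped_F w t = F w t.
Proof. by move=> tt wl; rewrite /clamped_F stop_id // clamp_id // subrr mulr0 addr0. Qed.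

Lemma clamped_path_continuous (w : R -> R) : continuous w ->
  continuous (fun t => clamp (level (stop t)) (w t)).
Proof.
move=> cw t.
have cl : {for t, continuous (fun x => level (stop x))}.
  by apply: continuous_comp; [exact: stop_continuous|exact: level_continuous].
apply: (@continuous_max _ _ (fun x => - level (stop x))
   (fun x => Num.min (level (stop x)) (w x))); first exact: cvgN.
by apply: (@continuous_min _ _ (fun x => level (stop x)) w) => //; exact: cw.
Qed.

Lemma clamped_dF_continuous (w : R -> R) : continuous w ->
  continuous (fun t => clamped_dF (w t) t).
Proof.
move=> cw t; have [_ [eF _]] := Fadm.
apply: (@continuous_along _ dF (fun x => clamp (level (stop x)) (w x)) stop) => //.
- exact: admissible_derive_continuous Fadm.
- exact: clamped_path_continuous.
- exact: stop_continuous.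
Qed.

Lemma clamped_F_continuous (w : R -> R) : continuous w ->
  continuous (fun t => clamped_F (w t) t).
Proof.
move=> cw t; have [[_ _ Fc] _] := Fadm.
apply: cvgD.
  apply: (@continuous_along _ F (fun x => clamp (level (stop x)) (w x)) stop) => //.
  - exact: admissible_equicontinuous Fadm.
  - exact: clamped_path_continuous.
  - exact: stop_continuous.
apply: cvgM; first exact: clamped_dF_continuous.
by apply: cvgB; [exact: cw|exact: clamped_path_continuous].
Qed.

(** The interval is cut at the two clamping levels. The middle piece obeys the mean value theorem
    for [F]; on the outer pieces the function is affine with slope [dF] at the level, so the same
    [e] works, and lengths add up. *)
Lemma clamped_mvt (t m e w w' : R) : w <= w' ->
  (forall z, w <= z <= w' -> `|clamped_dF z t - m| <= e) ->
  `|clamped_F w' t - clamped_F w t - m * (w' - w)| <= e * (w' - w).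
Proof.
move=> ww' h; rewrite /clamped_F.
have hw : `|clamped_dF w t - m| <= e by apply: h; rewrite lexx.
have hw' : `|clamped_dF w' t - m| <= e by apply: h; rewrite lexx andbT.
move: h hw hw'; rewrite /clamped_dF; set s := stop t; set a := level s => h hw hw'.
have a0 : 0 <= a := level_ge0 _.
have piece x y : w <= x -> x <= y -> y <= w' -> - a <= x -> y <= a ->
    `|F y s - F x s - m * (y - x)| <= e * (y - x).
  move=> wx xy yw' ax ya; apply: (admissible_mvt _ _ Fadm) => // z /andP[z1 z2].
  have <- : clamp a z = z by apply: clamp_id; rewrite ler_norml; apply/andP; split; lra.
  by apply: h; apply/andP; split; lra.
have mulP (x c : R) : 0 <= x -> `|c - m| <= e -> `|(c - m) * x| <= e * x.
  by move=> x0 c0; rewrite normrM (ger0_norm x0) ler_wpM2r.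
have tri (A B C a1 b1 c1 : R) : `|A| <= a1 -> `|B| <= b1 -> `|C| <= c1 ->
    `|A + B + C| <= a1 + b1 + c1.
  move=> hA hB hC; apply: le_trans (ler_normD _ _) _; apply: lerD => //.
  by apply: le_trans (ler_normD _ _) _; apply: lerD.
move: hw hw'; case: (clampP a w a0) => hwa; case: (clampP a w' a0) => hwa' hw hw'; try lra.
- have -> : F (- a) s + dF (- a) s * (w' - - a) - (F (- a) s + dF (- a) s * (w - - a))
    - m * (w' - w) = (dF (- a) s - m) * (w' - w) by ring.
  by apply: mulP => //; lra.
- have [h1 h2] := andP hwa'.
  have -> : F w' s + dF w' s * (w' - w') - (F (- a) s + dF (- a) s * (w - - a))
    - m * (w' - w) = (F w' s - F (- a) s - m * (w' - - a)) + (dF (- a) s - m) * (- a - w)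
     + 0 by ring.
  have -> : e * (w' - w) = e * (w' - - a) + e * (- a - w) + 0 by ring.
  by apply: tri; [apply: piece; lra|apply: mulP => //; lra|rewrite normr0].
- have -> : F a s + dF a s * (w' - a) - (F (- a) s + dF (- a) s * (w - - a))
    - m * (w' - w) = (F a s - F (- a) s - m * (a - - a)) + (dF (- a) s - m) * (- a - w)
     + (dF a s - m) * (w' - a) by ring.
  have -> : e * (w' - w) = e * (a - - a) + e * (- a - w) + e * (w' - a) by ring.
  by apply: tri; [apply: piece; lra|apply: mulP => //; lra|apply: mulP => //; lra].
- have [h1 h2] := andP hwa; have [h3 h4] := andP hwa'.
  have -> : F w' s + dF w' s * (w' - w') - (F w s + dF w s * (w - w)) - m * (w' - w) =
    F w' s - F w s - m * (w' - w) by ring.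
  by apply: piece.
- have [h1 h2] := andP hwa.
  have -> : F a s + dF a s * (w' - a) - (F w s + dF w s * (w - w))
    - m * (w' - w) = (F a s - F w s - m * (a - w)) + (dF a s - m) * (w' - a)
     + 0 by ring.
  have -> : e * (w' - w) = e * (a - w) + e * (w' - a) + 0 by ring.
  by apply: tri; [apply: piece; lra|apply: mulP => //; lra|rewrite normr0].
- have -> : F a s + dF a s * (w' - a) - (F a s + dF a s * (w - a))
    - m * (w' - w) = (dF a s - m) * (w' - w) by ring.
  by apply: mulP => //; lra.
Qed.

Lemma clamped_dF_lip (eps L : R) :
  (forall w t, `|w| <= rho -> t <= T -> `|dF w t| <= eps) ->
  (forall w t, `|w| <= level t1 -> t <= t1 -> `|dF w t| <= L) ->
  forall w t, `|clamped_dF w t| <= lip eps L T t.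
Proof.
move=> he hL w t; rewrite /lip /clamped_dF; case: ifPn => [tT|_].
  have tt : t <= t1 := le_trans tT Tt1.
  rewrite stop_id //; apply: he => //; rewrite level_early //.
  by apply: clamp_bound; exact: ltW.
apply: hL; last exact: stop_le.
by apply: le_trans (clamp_bound _ _ _) (level_le _ (stop_le t)).
Qed.

Lemma clamped_dF_unif (e : R) : 0 < e -> exists2 d : R, 0 < d &
  forall w w' t, `|w - w'| < d -> `|clamped_dF w t - clamped_dF w' t| < e.
Proof.
move=> e0; have [_ [eF _]] := Fadm; have [d d0 hd] := eF t1 (level t1) _ e0.
exists d => // w w' t ww'; apply: hd.
- exact: le_trans (clamp_bound _ _ _) (level_le _ (stop_le t)).
- exact: le_trans (clamp_bound _ _ _) (level_le _ (stop_le t)).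
- exact: stop_le.
- exact: le_lt_trans (clamp_nonexpansive _ _ _ _) ww'.
Qed.

End clamping.

(** * One-parameter families of bounded solutions of the clamped system *)

Section clamped_family.
Context {R : realType}.
Variables (lam mu : R) (F dF : R -> R -> R) (tau T0 rho : R).
Hypotheses (lam0 : 0 < lam) (mu0 : 0 < mu) (Fadm : admissible F dF) (rho0 : 0 < rho)
  (small : forall w t, `|w| <= rho -> t <= T0 -> `|dF w t| <= Num.min (lam / 8) (mu / 4)).

Local Notation G T slope := (clamped_F F dF T rho slope (tau + 1)).

Record dichotomic_family (T slope : R) (u v p q : R -> R -> R) : Prop := {
  family_u : forall s t : R,
    is_derive t 1 (u s) (lam * u s t + G T slope (u s t - v s t) t);
  family_v : forall s t : R,
    is_derive t 1 (v s) (- mu * v s t + G T slope (u s t - v s t) t);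
  family_T : forall s : R, u s T = s;
  family_decay : forall s (e : R), 0 < e ->
    exists T' : R, forall t, t <= T' -> `|u s t| <= e /\ `|v s t| <= e;
  family_bounded : forall s : R, exists C : R, forall t, t <= tau -> `|u s t| <= C /\ `|v s t| <= C;
  family_lipschitz : exists2 C : R, 0 < C & forall s s' t, t <= tau ->
    `|(u s' t - v s' t) - (u s t - v s t)| <= C * `|s' - s|
    /\ `|u s' t - u s t| <= C * `|s' - s|;
  family_derive : forall s : R,
    is_derive s 1 (fun x => u x tau) (p s tau) /\ is_derive s 1 (fun x => v x tau) (q s tau);
  family_derive_continuous : forall s : R,
    {for s, continuous (fun x => p x tau)} /\ {for s, continuous (fun x => q x tau)};
  family_immersed : forall s : R, ~ (p s tau = 0 /\ q s tau = 0);
  family_unique : forall u' v' : R -> R,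
    (forall t : R, t <= tau ->
       is_derive t 1 u' (lam * u' t + G T slope (u' t - v' t) t)) ->
    (forall t : R, t <= tau ->
       is_derive t 1 v' (- mu * v' t + G T slope (u' t - v' t) t)) ->
    (exists C : R, forall t, t <= tau -> `|u' t| <= C /\ `|v' t| <= C) ->
    forall t, t <= tau -> u' t = u (u' T) t /\ v' t = v (u' T) t;
  family_backward : forall s s', u s tau = u s' tau -> v s tau = v s' tau -> s = s' }.

Lemma dichotomic_family_exists (T slope : R) : T <= T0 -> T <= tau -> 0 <= slope ->
  exists u v p q, dichotomic_family T slope u v p q.
Proof.
move=> TT0 Ttau slope0; set g := G T slope; pose dg := clamped_dF dF T rho slope (tau + 1).
have Tt1 : T <= tau + 1 by lra.
pose eps := Num.min (lam / 8) (mu / 4).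
have eps0 : 0 < eps by rewrite lt_min !divr_gt0.
have eps_lam : eps <= lam / 8 by rewrite ge_min lexx.
have eps_mu : eps <= mu / 4 by rewrite ge_min lexx orbT.
have [M hM] := admissible_derive_bounded _ _ Fadm (tau + 1) (level T rho slope (tau + 1)).
pose L := Num.max M eps; pose nu := lam + 4 * L.
have eps_L : eps <= L by rewrite le_max lexx orbT.
have L_nu : L <= (nu - lam) / 4 by rewrite /nu; lra.
have g0 t : g 0 t = 0 by exact: clamped_F0.
have gcont (w : R -> R) : continuous w -> continuous (fun t => g (w t) t).
  exact: clamped_F_continuous.
have dgcont (w : R -> R) : continuous w -> continuous (fun t => dg (w t) t).
  exact: (clamped_dF_continuous F dF Fadm).
have dglip w t : `|dg w t| <= lip eps L T t.
  apply: clamped_dF_lip => // [x r xr rT|x r xr rT].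
    by apply: small => //; exact: le_trans rT TT0.
  by apply: le_trans (hM x r xr rT) _; rewrite le_max lexx.
have dgunif (e : R) : 0 < e -> exists2 d : R, 0 < d &
    forall w w' t, `|w - w'| < d -> `|dg w t - dg w' t| < e.
  exact: (clamped_dF_unif F dF Fadm).
have gmvt (t m e w w' : R) : w <= w' ->
    (forall z, w <= z <= w' -> `|dg z t - m| <= e) ->
    `|g w' t - g w t - m * (w' - w)| <= e * (w' - w).
  exact: clamped_mvt.
have glip := mvt_lip eps L T g dg dglip gmvt.
(* The largest rate allowed; being positive, it yields decay at [-oo]. *)
pose th := lam / 2.
have thl : 0 <= th <= lam / 2 by rewrite /th lexx divr_ge0 // ltW.
have th0 : 0 <= th by case/andP: thl.
have [X XP] := choice (fun s => @dichotomic_solution_exists _ lam mu nu eps L T lam0 mu0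
  eps0 eps_lam eps_mu eps_L L_nu g g0 gcont glip th s thl).
pose u s := (X s).1; pose v s := (X s).2.
pose gY s (w t : R) := dg (u s t - v s t) t * w.
have Yex s : exists uv : (R -> R) * (R -> R),
    dichotomic_solution lam mu nu T (gY s) th 1 uv.1 uv.2.
  have [du dv _ _] := XP s.
  apply: (@dichotomic_solution_exists _ lam mu nu eps L T) => //.
  - by move=> t; rewrite /gY mulr0.
  - move=> w cw t; apply: cvgM; last exact: cw.
    apply: (dgcont (fun t => u s t - v s t)) => r.
    by apply: cvgB; [exact: is_derive_continuous (du r)|exact: is_derive_continuous (dv r)].
  - by move=> t w w'; rewrite /gY -mulrBr normrM ler_wpM2r.
have [Y YP] := choice Yex.
pose p s := (Y s).1; pose q s := (Y s).2.
have wW t : t <= tau -> wt nu T th t <= expR (nu * (tau - T)).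
  by move=> tt; apply: (@wt_le _ lam mu nu eps L T).
pose W := expR (nu * (tau - T)); have W0 : 0 < W := expR_gt0 _.
have gback (t0 : R) (a b a' b' : R -> R) : t0 <= tau ->
    (forall t : R, t0 <= t <= tau -> is_derive t 1 a (lam * a t + g (a t - b t) t)) ->
    (forall t : R, t0 <= t <= tau -> is_derive t 1 b (- mu * b t + g (a t - b t) t)) ->
    (forall t : R, t0 <= t <= tau -> is_derive t 1 a' (lam * a' t + g (a' t - b' t) t)) ->
    (forall t : R, t0 <= t <= tau -> is_derive t 1 b' (- mu * b' t + g (a' t - b' t) t)) ->
    a tau = a' tau -> b tau = b' tau -> a t0 = a' t0.
  move=> t0t da db da' db' eqa eqb.
  have := @backward_zero R lam mu L t0 tau (fun t => a t - a' t) (fun t => b t - b' t)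
    (fun t => g (a t - b t) t - g (a' t - b' t) t) (ltW lam0) (ltW mu0) t0t.
  case.
  - by move=> t ht; have h1 := da t ht; have h2 := da' t ht; apply: is_derive_eq; ring.
  - by move=> t ht; have h1 := db t ht; have h2 := db' t ht; apply: is_derive_eq; ring.
  - move=> t ht; apply: le_trans (glip _ _ _) _.
    have -> : a t - a' t - (b t - b' t) = a t - b t - (a' t - b' t) by ring.
    by rewrite ler_wpM2r // /lip; case: ifP.
  - by rewrite eqa subrr.
  - by rewrite eqb subrr.
  - by move=> /eqP; rewrite subr_eq0 => /eqP.
exists u, v, p, q; split.
- by move=> s t; have [h _ _ _] := XP s; exact: h.
- by move=> s t; have [_ h _ _] := XP s; exact: h.
- by move=> s; have [_ _ h _] := XP s; exact: h.
- move=> s e e0; have [_ _ _ B] := XP s.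
  have c0 : 0 < 2 * `|s| + 1 by have := normr_ge0 s; lra.
  have [x x0 xE] := expR_small _ _ c0 e0.
  have thp : 0 < th by rewrite divr_gt0.
  have bnd t : t <= T - x / th -> 2 * `|s| * wt nu T th t <= e.
    move=> tx; have tT : t <= T by have := divr_gt0 x0 thp; lra.
    apply: le_trans (ltW xE); apply: ler_pM; rewrite ?mulr_ge0 ?(ltW (wt_gt0 _ _ _ _)) //.
      by rewrite lerDl.
    rewrite /wt tT ler_expR -lerN2 opprK -mulrN mulrC -ler_pdivrMr //; lra.
  by exists (T - x / th) => t /bnd h; have [_ h1 h2] := B t; split; exact: le_trans h.
- move=> s; have [_ _ _ B] := XP s; exists (2 * `|s| * W) => t tt.
  have [_ h1 h2] := B t; have wl : 2 * `|s| * wt nu T th t <= 2 * `|s| * W.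
    by rewrite ler_wpM2l ?mulr_ge0 // wW.
  by split; [exact: le_trans h1 wl|exact: le_trans h2 wl].
- exists (2 * W) => [|s s' t tt]; first by rewrite mulr_gt0.
  have [h1 h2 _] := @dichotomic_dependence _ lam mu nu eps L T lam0 mu0 eps0 eps_lam eps_mu
    eps_L L_nu g dg dglip gmvt th thl u v XP s s' t.
  have wl : 2 * `|s' - s| * wt nu T th t <= 2 * W * `|s' - s|.
    by rewrite mulrAC ler_wpM2r // ler_wpM2l // wW.
  by split; [exact: le_trans h1 wl|exact: le_trans h2 wl].
- move=> s; exact: (@dichotomic_derive _ lam mu nu eps L T lam0 mu0 eps0 eps_lam eps_mu
    eps_L L_nu g dg dglip dgunif gmvt th thl u v p q XP YP s tau).
- move=> s; exact: (@dichotomic_derive_continuous _ lam mu nu eps L T lam0 mu0 eps0 eps_lam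
    eps_mu eps_L L_nu g dg dglip dgunif gmvt th thl u v p q XP YP s tau).
(* Vanishing velocity at [tau] would propagate back to [T], where [p s] equals 1. *)
- move=> s [pz qz]; have [dp dq pT _] := YP s.
  have [] := @backward_zero R lam mu L T tau (p s) (q s) (fun t => gY s (p s t - q s t) t)
    (ltW lam0) (ltW mu0) Ttau (fun t _ => dp t) (fun t _ => dq t) _ pz qz.
    move=> t _; rewrite /gY normrM ler_wpM2r //; apply: le_trans (dglip _ _) _.
    by rewrite /lip; case: ifP.
  by move=> h _; move: pT; rewrite -/(p s) h => /eqP; rewrite eq_sym oner_eq0.
- move=> u' v' du' dv' [C B'] t tt.
  pose s := u' T; have [du dv uT _] := XP s.
  have [C0 B0] : exists C0 : R, forall r, r <= tau -> `|u s r| <= C0 /\ `|v s r| <= C0.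
    have [_ _ _ B] := XP s; exists (2 * `|s| * W) => r rr.
    have [_ h1 h2] := B r; have wl : 2 * `|s| * wt nu T th r <= 2 * `|s| * W.
      by rewrite ler_wpM2l ?mulr_ge0 // wW.
    by split; [exact: le_trans h1 wl|exact: le_trans h2 wl].
  pose U r := u' r - u s r; pose V r := v' r - v s r.
  pose b r := g (u' r - v' r) r - g (u s r - v s r) r.
  have UVE r : U r - V r = u' r - v' r - (u s r - v s r) by rewrite /U /V; ring.
  (* The competitor is only bounded, so the difference is compared with the weight of rate 0, which
     is 1 before [T]. *)
  have th00 : 0 <= (0 : R) <= lam / 2 by rewrite lexx divr_ge0 // ltW.
  have Ub r : r <= tau -> `|U r| <= C + C0.
    move=> rr; have [h1 _] := B' r rr; have [h2 _] := B0 r rr.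
    by apply: le_trans (ler_normB _ _) _; apply: lerD.
  have Vb r : r <= tau -> `|V r| <= C + C0.
    move=> rr; have [_ h1] := B' r rr; have [_ h2] := B0 r rr.
    by apply: le_trans (ler_normB _ _) _; apply: lerD.
  have wt1 r : 1 <= wt nu T 0 r.
    rewrite /wt -expR0 ler_expR; case: ifPn => [_|]; first by rewrite mul0r.
    rewrite -ltNge => Tr; apply: mulr_ge0; last lra.
    by rewrite /nu; have := le_trans (ltW eps0) eps_L; lra.
  have dU (r : R) : r <= tau -> is_derive r 1 U (lam * U r + b r).
    move=> rr; have h1 : is_derive r 1 u' (lam * u' r + g (u' r - v' r) r) := du' r rr.
    have h2 : is_derive r 1 (u s) (lam * u s r + g (u s r - v s r) r) := du r.
    by rewrite /U; apply: is_derive_eq; rewrite /b; ring.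
  have dV (r : R) : r <= tau -> is_derive r 1 V (- mu * V r + b r).
    move=> rr; have h1 : is_derive r 1 v' (- mu * v' r + g (u' r - v' r) r) := dv' r rr.
    have h2 : is_derive r 1 (v s) (- mu * v s r + g (u s r - v s r) r) := dv r.
    by rewrite /V; apply: is_derive_eq; rewrite /b; ring.
  have CC : 0 <= C + C0 by exact: le_trans (normr_ge0 _) (Ub T Ttau).
  have wD r : r <= tau -> `|U r - V r| <= (2 * (C + C0)) * wt nu T 0 r.
    move=> rr; apply: (@le_trans _ _ (2 * (C + C0))); last by rewrite ler_peMr // mulr_ge0.
    by apply: le_trans (ler_normB _ _) _; have := Ub r rr; have := Vb r rr; lra.
  have bE r : r <= tau -> `|b r| <= lip eps L T r * (`|U r - V r| + 0 * wt nu T 0 r).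
    by move=> rr; rewrite mul0r addr0 UVE; exact: glip.
  have VbT r : r <= T -> `|V r| <= C + C0 by move=> rT; apply: Vb; exact: le_trans rT Ttau.
  have [_ hU hV] := @dichotomy_bound _ lam mu nu eps L T lam0 mu0 eps0 eps_lam eps_mu eps_L
    L_nu 0 tau 0 (C + C0) (2 * (C + C0)) U V b Ttau th00 (lexx _) dU dV VbT wD bE t tt.
  have UT : U T = 0 by rewrite /U /u uT subrr.
  move: hU hV; rewrite UT normr0 mulr0 addr0 mul0r !normr_le0 /U /V !subr_eq0.
  by move=> /eqP -> /eqP ->.
- move=> s s' eu ev; have [du dv uT _] := XP s; have [du' dv' uT' _] := XP s'.
  rewrite -uT -uT'.
  by apply: (gback T (u s) (v s) (u s') (v s')) => // t _.
Qed.

End clamped_family.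
Arguments family_u {R lam mu F dF tau rho T slope u v p q}.
Arguments family_v {R lam mu F dF tau rho T slope u v p q}.
Arguments family_T {R lam mu F dF tau rho T slope u v p q}.
Arguments family_decay {R lam mu F dF tau rho T slope u v p q}.
Arguments family_lipschitz {R lam mu F dF tau rho T slope u v p q}.
Arguments family_derive {R lam mu F dF tau rho T slope u v p q}.
Arguments family_derive_continuous {R lam mu F dF tau rho T slope u v p q}.
Arguments family_immersed {R lam mu F dF tau rho T slope u v p q}.
Arguments family_unique {R lam mu F dF tau rho T slope u v p q}.
Arguments family_backward {R lam mu F dF tau rho T slope u v p q}.

(** * Charts of the set of backward solutions *)

Section backward_set.
Context {R : realType}.
Variables (lam mu : R) (F dF : R -> R -> R) (tau : R).

(** The margin [tau < t1] reflects that trajectories live on open intervals, and makes the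
    derivative at [tau] two-sided. *)
Definition backward_solution (t1 : R) (u v : R -> R) : Prop :=
  [/\ tau < t1,
      forall t : R, t < t1 -> is_derive t 1 u (lam * u t + F (u t - v t) t),
      forall t : R, t < t1 -> is_derive t 1 v (- mu * v t + F (u t - v t) t)
    & forall e : R, 0 < e -> exists T, forall t : R, t <= T -> `|u t| <= e /\ `|v t| <= e].

Definition backward_set : set (R * R) := [set Q | exists t1 u v,
  backward_solution t1 u v /\ (u tau, v tau) = Q].

Hypotheses (lam0 : 0 < lam) (mu0 : 0 < mu) (Fadm : admissible F dF).

Let backward_bounded (t1 : R) (u v : R -> R) : backward_solution t1 u v ->
  exists C : R, forall t, t <= tau -> `|u t| <= C /\ `|v t| <= C.
Proof.
move=> [tau1 du dv uv0]; have [T hT] := uv0 1 ltr01.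
have bound (z dz : R -> R) : (forall t : R, t < t1 -> is_derive t 1 z (dz t)) ->
    exists C : R, forall t, T <= t -> t <= tau -> `|z t| <= C.
  move=> dzE; have [c _ hc] : exists2 c, c \in `[Num.min T tau, tau] &
      forall t, t \in `[Num.min T tau, tau] -> `|z t| <= `|z c|.
    apply: (@EVT_max _ (fun t => `|z t|)); first by rewrite ge_min lexx orbT.
    apply/continuous_in_subspaceT => x; rewrite inE /= in_itv /= => /andP[_ xt].
    by apply: cvg_norm; apply: is_derive_continuous (dzE x _); exact: le_lt_trans xt tau1.
  by exists `|z c| => t Tt tt; apply: hc; rewrite in_itv /= tt ge_min Tt.
have [C hC] := bound _ _ du; have [D hD] := bound _ _ dv.
exists (1 + `|C| + `|D|) => t tt.
have c0 := normr_ge0 C; have d0 := normr_ge0 D.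
have [tT|/ltW Tt] := leP t T.
  by have [h1 h2] := hT t tT; split; lra.
have h1 := hC t Tt tt; have h2 := hD t Tt tt.
by have := ler_norm C; have := ler_norm D; split; lra.
Qed.

Let backward_determined (t1 t1' : R) (u v u' v' : R -> R) :
  backward_solution t1 u v -> backward_solution t1' u' v' ->
  u tau = u' tau -> v tau = v' tau -> forall t, t <= tau -> u t = u' t /\ v t = v' t.
Proof.
move=> S S' eu ev t tt.
have [C hC] := backward_bounded t1 u v S; have [C' hC'] := backward_bounded t1' u' v' S'.
have [tau1 du dv _] := S; have [tau1' du' dv' _] := S'.
have [M hM] := admissible_lipschitz _ _ Fadm tau (2 * `|C| + 2 * `|C'|).
have c0 := normr_ge0 C; have c1 := normr_ge0 C'.
have h1 := ler_norm C; have h2 := ler_norm C'.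
have := @backward_zero R lam mu M t tau (fun r => u r - u' r) (fun r => v r - v' r)
  (fun r => F (u r - v r) r - F (u' r - v' r) r) (ltW lam0) (ltW mu0) tt.
case.
- move=> r /andP[_ rt].
  have k1 : is_derive r 1 u (lam * u r + F (u r - v r) r) by apply: du; exact: le_lt_trans rt tau1.
  have k2 : is_derive r 1 u' (lam * u' r + F (u' r - v' r) r).
    by apply: du'; exact: le_lt_trans rt tau1'.
  by apply: is_derive_eq; ring.
- move=> r /andP[_ rt].
  have k1 : is_derive r 1 v (- mu * v r + F (u r - v r) r) by apply: dv; exact: le_lt_trans rt tau1.
  have k2 : is_derive r 1 v' (- mu * v' r + F (u' r - v' r) r).
    by apply: dv'; exact: le_lt_trans rt tau1'.
  by apply: is_derive_eq; ring.
- move=> r /andP[_ rt].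
  have -> : u r - u' r - (v r - v' r) = u r - v r - (u' r - v' r) by ring.
  have [k1 k2] := hC r rt; have [k3 k4] := hC' r rt.
  apply: hM => //; apply: le_trans (ler_normB _ _) _; lra.
- by rewrite eu subrr.
- by rewrite ev subrr.
by move=> /eqP + /eqP; rewrite !subr_eq0 => /eqP -> /eqP ->.
Qed.

Variables (a11 a12 a21 a22 : R).
Hypothesis det0 : a11 * a22 - a12 * a21 != 0.

Definition planar_map (Q : R * R) : R * R :=
  (a11 * Q.1 + a12 * Q.2, a21 * Q.1 + a22 * Q.2).

Lemma planar_map_inj : injective planar_map.
Proof.
move=> [x y] [x' y'] [/= e1 e2].
have h1 : (a11 * a22 - a12 * a21) * (x - x') = 0.
  have -> : (a11 * a22 - a12 * a21) * (x - x') =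
    a22 * ((a11 * x + a12 * y) - (a11 * x' + a12 * y'))
    - a12 * ((a21 * x + a22 * y) - (a21 * x' + a22 * y')) by ring.
  by rewrite e1 e2 !subrr !mulr0 subrr.
have h2 : (a11 * a22 - a12 * a21) * (y - y') = 0.
  have -> : (a11 * a22 - a12 * a21) * (y - y') =
    a11 * ((a21 * x + a22 * y) - (a21 * x' + a22 * y'))
    - a21 * ((a11 * x + a12 * y) - (a11 * x' + a12 * y')) by ring.
  by rewrite e1 e2 !subrr !mulr0 subrr.
move/eqP: h1; move/eqP: h2; rewrite !mulf_eq0 (negPf det0) /= !subr_eq0.
by move=> /eqP -> /eqP ->.
Qed.

Let planar_C1 (V : set R) (u v p q : R -> R) :
  (forall s, V s -> is_derive s 1 u (p s) /\ is_derive s 1 v (q s)) -> open V ->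
  (forall s, V s -> {for s, continuous p} /\ {for s, continuous q}) ->
  (forall s, V s -> ~ (p s = 0 /\ q s = 0)) ->
  C1_regular V (fun s => planar_map (u s, v s)).
Proof.
move=> duv oV cpq pq0.
have dpl s : V s -> is_derive s 1 (fun s => planar_map (u s, v s)) (planar_map (p s, q s)).
  move=> Vs; have [du dv] := duv s Vs.
  have d1 : is_derive s 1 (fun s => a11 * u s + a12 * v s) (a11 * p s + a12 * q s).
    by apply: is_derive_eq; rewrite /GRing.scale /=; ring.
  have d2 : is_derive s 1 (fun s => a21 * u s + a22 * v s) (a21 * p s + a22 * q s).
    by apply: is_derive_eq; rewrite /GRing.scale /=; ring.
  have lim_pl : h^-1 *: (planar_map (u (h *: 1 + s), v (h *: 1 + s))
      - planar_map (u s, v s)) @[h --> 0^'] --> planar_map (p s, q s).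
    have c1 : h^-1 *: ((a11 * u (h *: 1 + s) + a12 * v (h *: 1 + s))
        - (a11 * u s + a12 * v s)) @[h --> 0^'] --> a11 * p s + a12 * q s.
      by have [+ <-] := d1.
    have c2 : h^-1 *: ((a21 * u (h *: 1 + s) + a22 * v (h *: 1 + s))
        - (a21 * u s + a22 * v s)) @[h --> 0^'] --> a21 * p s + a22 * q s.
      by have [+ <-] := d2.
    exact: cvg_pair c1 c2.
  by split; [apply/cvg_ex; exists (planar_map (p s, q s))|exact/cvg_lim].
move=> s Vs; have [d1 d2] := dpl s Vs; split; first exact: d1.
- have E : \near s, planar_map (p s, q s) = derive1 (fun s => planar_map (u s, v s)) s.
    have : nbhs s V by apply: open_nbhs_nbhs; split.
    by apply: filterS => x Vx; rewrite derive1E; have [_ ->] := dpl x Vx.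
  have [cp cq] := cpq s Vs.
  rewrite /prop_for /continuous_at -(nbhs_singleton E).
  apply: (cvg_trans (near_eq_cvg E)).
  have comb (a b : R) : a * p x + b * q x @[x --> s] --> a * p s + b * q s.
    by apply: cvgD; apply: cvgM; (exact: cvg_cst || exact: cp || exact: cq).
  exact: cvg_pair (comb a11 a12) (comb a21 a22).
- rewrite derive1E d2; apply/eqP => e; apply: (pq0 s Vs).
  have : planar_map (p s, q s) = planar_map (0, 0).
    by rewrite e /planar_map /= !mulr0 !addr0.
  by move/planar_map_inj => [].
Qed.

(** Index [k] moves the time [T k] to the left and steepens the slope at once, so a single integer
    eventually accommodates both the time at which a solution becomes small and its size up to
    [tau]. *)
Lemma backward_set_charts : exists (V : nat -> set R) (c : nat -> R -> R * R),
  chart_family (planar_map @` backward_set) V c.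
Proof.
have eps0 : 0 < Num.min (lam / 8) (mu / 4) by rewrite lt_min !divr_gt0.
have [T1 [rho [rho0 small]]] := admissible_derive_small _ _ Fadm _ eps0.
pose T0 := Num.min T1 tau.
pose T (k : nat) := T0 - k%:R.
have TT0 k : T k <= T1.
  by apply: (@le_trans _ _ T0); [rewrite gerBl|rewrite ge_min lexx].
have Ttau k : T k <= tau.
  by apply: (@le_trans _ _ T0); [rewrite gerBl|rewrite ge_min lexx orbT].
have fam_ex (k : nat) : exists X : (R -> R -> R) * (R -> R -> R) * (R -> R -> R) * (R -> R -> R),
    dichotomic_family lam mu F dF tau rho (T k) k%:R X.1.1.1 X.1.1.2 X.1.2 X.2.
  have [u [v [p [q h]]]] := @dichotomic_family_exists R lam mu F dF tau T1 rho
    lam0 mu0 Fadm rho0 small (T k) k%:R (TT0 k) (Ttau k) (ler0n _ k).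
  by exists (u, v, p, q).
have [X XP] := choice fam_ex.
pose u k := (X k).1.1.1; pose v k := (X k).1.1.2.
pose p k := (X k).1.2; pose q k := (X k).2.
have fam k : dichotomic_family lam mu F dF tau rho (T k) k%:R (u k) (v k) (p k) (q k) := XP k.
pose lev k := level (T k) rho k%:R.
(* The uniform margin [m] is essential: the half-line is not compact, and pointwise strict
   inequality would not give openness. *)
pose V k := [set s : R | exists2 m : R, 0 < m &
  forall t, t <= tau -> `|u k s t - v k s t| <= lev k t - m].
pose c k s := planar_map (u k s tau, v k s tau).
have GF k w t : t <= tau + 1 -> `|w| <= lev k t ->
    clamped_F F dF (T k) rho k%:R (tau + 1) w t = F w t.
  by move=> *; exact: clamped_FE.
(* a point of [V k] stays strictly below the level slightly beyond [tau] *)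
have Vsol k s : V k s -> exists t1, backward_solution t1 (u k s) (v k s).
  move=> [m m0 hm].
  have du := family_u (fam k) s.
  have dv := family_v (fam k) s.
  have cw : {for tau, continuous (fun t => lev k t - `|u k s t - v k s t|)}.
    apply: cvgB; first exact: level_continuous.
    apply: cvg_norm; apply: cvgB.
      exact: is_derive_continuous (du tau).
    exact: is_derive_continuous (dv tau).
  move/cvgrPdist_lt : cw => /(_ _ m0) [/= d d0 hd].
  have lw (t : R) : t < tau + Num.min d 1 -> t <= tau + 1 /\ `|u k s t - v k s t| <= lev k t.
    move=> tt; have td : t < tau + d.
      by apply: lt_le_trans tt _; rewrite lerD2l ge_min lexx.
    have t1 : t <= tau + 1.
      by apply/ltW; apply: lt_le_trans tt _; rewrite lerD2l ge_min lexx orbT.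
    split=> //; have [ttau|taut] := leP t tau; first by have := hm t ttau; lra.
    have := hd t; rewrite /= distrC ger0_norm; last lra.
    have tdd : t - tau < d by lra.
    move=> /(_ tdd); rewrite ltr_norml => /andP[_ h].
    by have := hm tau (lexx _); lra.
  exists (tau + Num.min d 1); split.
  - by rewrite ltrDl lt_min d0 ltr01.
  - by move=> t /lw[h1 h2]; rewrite -(GF k) //; exact: du.
  - by move=> t /lw[h1 h2]; rewrite -(GF k) //; exact: dv.
  - by move=> e e0; exact: (family_decay (fam k)).
(* Below the level a genuine solution also solves the clamped system, so uniqueness of bounded
   solutions identifies it with the family member having the same value at [T k]. *)
have captured k t1 u' v' (m : R) : backward_solution t1 u' v' -> 0 < m ->
    (forall t, t <= tau -> `|u' t - v' t| <= lev k t - m) ->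
    V k (u' (T k)) /\ forall t, t <= tau ->
      u' t = u k (u' (T k)) t /\ v' t = v k (u' (T k)) t.
  move=> S m0 hm; have [tau1 du dv _] := S.
  have bnd := backward_bounded _ _ _ S.
  have lw (t : R) : t <= tau -> clamped_F F dF (T k) rho k%:R (tau + 1) (u' t - v' t) t =
      F (u' t - v' t) t.
    by move=> tt; apply: GF; [lra|have := hm t tt; lra].
  have eqs : forall t, t <= tau -> u' t = u k (u' (T k)) t /\ v' t = v k (u' (T k)) t.
    apply: (family_unique (fam k) u' v') => // t tt.
      by rewrite lw //; apply: du; exact: le_lt_trans tt tau1.
    by rewrite lw //; apply: dv; exact: le_lt_trans tt tau1.
  split=> //; exists m => // t tt; have [<- <-] := eqs t tt; exact: hm.
have lip k s (m : R) : 0 < m -> exists2 d : R, 0 < d & forall z, `|z - s| < d ->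
    forall t, t <= tau -> `|u k z t - v k z t| <= `|u k s t - v k s t| + m
       /\ `|u k z t - u k s t| <= m.
  move=> m0; have [C C0 hC] := family_lipschitz (fam k).
  exists (m / C); first by rewrite divr_gt0.
  move=> z zs t tt; have [h1 h2] := hC s z t tt.
  have zm : C * `|z - s| <= m by rewrite mulrC -ler_pdivlMr //; exact: ltW.
  split; last exact: le_trans h2 zm.
  have -> : u k z t - v k z t = (u k s t - v k s t) +
    ((u k z t - v k z t) - (u k s t - v k s t)) by ring.
  by apply: le_trans (ler_normD _ _) _; rewrite lerD2l; exact: le_trans h1 zm.
have Vopen k : open (V k).
  rewrite openE => s [m m0 hm]; have m2 : 0 < m / 2 by rewrite divr_gt0.
  have [d d0 hd] := lip k s _ m2.
  exists d => //= z zs; exists (m / 2) => // t tt.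
  have {}zs : `|z - s| < d by rewrite distrC.
  by have [h _] := hd z zs t tt; have := hm t tt; lra.
exists V, c; split; split.
- exact: Vopen.
- move=> k s Vs; have [t1 S] := Vsol k s Vs.
  by exists (u k s tau, v k s tau) => //; exists t1, (u k s), (v k s).
- move=> _ [_ [t1 [u' [v' [S <-]]]] <-].
  have [C hC] := backward_bounded _ _ _ S.
  have [_ _ _ S0] := S.
  have rho4 : 0 < rho / 4 by rewrite divr_gt0.
  have [T' hT'] := S0 _ rho4.
  (* The second term puts [T k] at least 1 before [T'], where the solution is already small. After
     [T'] the level is thus at least [rho + k], and the first term makes this exceed the global
     bound [2 * C] on [|u' - v'|]. *)
  pose k := Num.bound (`|2 * C| + `|T0 - T' + 1|).
  have hk : `|2 * C| + `|T0 - T' + 1| < k%:R by apply: archi_boundP; rewrite addr_ge0.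
  have rho2 : 0 < rho / 2 by rewrite divr_gt0.
  have [Vk eqs] : V k (u' (T k)) /\ forall t, t <= tau ->
      u' t = u k (u' (T k)) t /\ v' t = v k (u' (T k)) t.
    apply: (captured k t1 u' v' _ S rho2) => t tt.
    apply: le_trans (ler_normB _ _) _.
    have [tT'|T't] := leP t T'.
      have [h1 h2] := hT' t tT'; have := level_ge (T k) rho k%:R (ler0n _ k) t.
      rewrite -/(lev k t); lra.
    have [h1 h2] := hC t tt.
    have Tk : 1 <= t - T k.
      have := ler_norm (T0 - T' + 1); have := normr_ge0 (2 * C); rewrite /T; lra.
    have : k%:R <= k%:R * Num.max 0 (t - T k).
      by rewrite ler_peMr // le_max Tk orbT.
    rewrite /lev /level; have := ler_norm (2 * C); have := normr_ge0 (T0 - T' + 1); lra.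
  exists k, (u' (T k)) => //.
  by rewrite /c; have [<- <-] := eqs tau (lexx _).
- move=> k s s' _ _ /planar_map_inj[].
  exact: (family_backward (fam k)).
- move=> k; apply: (planar_C1 _ (fun s => u k s tau) (fun s => v k s tau)
    (fun s => p k s tau) (fun s => q k s tau)) => // s _.
  + exact: (family_derive (fam k)).
  + exact: (family_derive_continuous (fam k)).
  + exact: (family_immersed (fam k)).
- move=> j k s s' Vs Vs' /planar_map_inj[eu ev] O nO.
  have [t1 S] := Vsol j s Vs; have [t1' S'] := Vsol k s' Vs'.
  have eqs := backward_determined _ _ _ _ _ _ S S' eu ev.
  have [m m0 hm] := Vs'.
  have m2 : 0 < m / 2 by rewrite divr_gt0.
  have [d d0 hd] := lip j s _ m2.
  have [/= e e0 hO] := nO; have e2 : 0 < e / 2 by rewrite divr_gt0.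
  have [d' d'0 hd'] := lip j s _ e2.
  have := Vopen j; rewrite openE => /(_ _ Vs) nV.
  near=> z.
  have Vz : V j z by near: z.
  have zd : `|z - s| < d by near: z; exists d => //= x; rewrite distrC.
  have zd' : `|z - s| < d' by near: z; exists d' => //= x; rewrite distrC.
  have [t2 Sz] := Vsol j z Vz.
  (* The nearby solution of family [j] stays within [m / 2] of the common one, which lies below
     level [k] by [m]; hence family [k] captures it, and its value at [T k] is the new parameter. *)
  have wz t : t <= tau -> `|u j z t - v j z t| <= lev k t - m / 2.
    move=> tt; have [h _] := hd z zd t tt; have := hm t tt.
    have [<- <-] := eqs t tt; lra.
  have [Vk eqz] := captured k _ _ _ _ Sz m2 wz.
  exists (u j z (T k)).
    split => //; apply: hO => /=.
    have us' : u k s' (T k) = s' := family_T (fam k) s'.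
    have [us _] := eqs (T k) (Ttau k).
    rewrite -us' -us distrC; have [_ h] := hd' z zd' (T k) (Ttau k).
    by apply: le_lt_trans h _; lra.
  by rewrite /c; have [<- <-] := eqz tau (lexx _).
Unshelve.
all: try by end_near.
Qed.

End backward_set.

(** * The Fowler system *)

Section fowler_reduction.
Context {R : realType}.
Variables (n : R) (f : R -> R -> R) (h : R -> R) (l e a b sg : R).
Hypotheses (f_diff : forall u r : R, 0 < r ->
       differentiable (fun p : R * R => f p.1 p.2) (u, r))
  (h_diff : forall r : R, 0 < r -> derivable h r 1)
  (g0 : forall t, g_ f l 0 t = 0 /\ dg_ f l 0 t = 0)
  (ab_sum : a + b = n - 2) (ab_prod : a * b = e) (ab_neq : a - b != 0)
  (sg2 : sg * sg = 1)
  (lam_gt0 : 0 < sg * (alpha_ l - b)) (mu_gt0 : 0 < sg * (a - alpha_ l))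
  (h_lim : forall d : R, 0 < d -> exists T : R, forall t, t <= T ->
     `|h (expR (sg * t)) - e| <= d)
  (dg_unif : forall tau : R,
     unif_cont_on_compacts (fun x t => dg_ f l x (sg * t)) [set t | t <= tau]).

(* With [sg = -1] time is reversed, which exchanges the roles of the two
   invariant directions [y + a x] and [y + b x]. *)
Definition fowler_F (w t : R) : R :=
  sg * (- (h (expR (sg * t)) - e) * (w / (a - b)) - g_ f l (w / (a - b)) (sg * t)).
Definition fowler_dF (w t : R) : R :=
  sg * (- (h (expR (sg * t)) - e) / (a - b) - dg_ f l (w / (a - b)) (sg * t) / (a - b)).

Let norm_sg : `|sg| = 1.
Proof.
have : `|sg| ^+ 2 = 1 by rewrite -normrX expr2 sg2 normr1.
by move=> /eqP; rewrite sqrf_eq1 => /orP[/eqP //|/eqP h1]; have := normr_ge0 sg; lra.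
Qed.

Let is_derive_sg (z : R -> R) (d t : R) :
  is_derive (sg * t) 1 z d -> is_derive t 1 (fun r => z (sg * r)) (sg * d).
Proof.
move=> dz; have h1 : is_derive t 1 (fun r : R => sg * r) sg.
  by apply: is_derive_eq; rewrite /GRing.scale /=; ring.
by rewrite mulrC; apply: (@is_derive1_comp _ z (fun r => sg * r)).
Qed.

Let is_derive_g (x t : R) : is_derive x 1 (fun z => g_ f l z t) (dg_ f l x t).
Proof.
suff : derivable (fun z => g_ f l z t) x 1.
  by move=> dg; split; [exact: dg|rewrite /dg_ derive1E].
apply/derivable1_diffP.
have d1 : differentiable (fun z : R => (z * expR (- (alpha_ l * t)), expR t)) x.
  by apply: differentiable_pair.
have d2 : differentiable ((fun p : R * R => f p.1 p.2) \o
    (fun z : R => (z * expR (- (alpha_ l * t)), expR t))) x.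
  by apply: differentiable_comp => //; apply: f_diff; exact: expR_gt0.
by apply: differentiableM.
Qed.

Let sg_continuous : continuous (fun t : R => sg * t).
Proof. by move=> t; apply: cvgM; [exact: cvg_cst|exact: cvg_id]. Qed.

Let g_continuous (x : R) : continuous (fun t => g_ f l x (sg * t)).
Proof.
move=> t; pose G t := g_ f l x t; suff : {for sg * t, continuous G}.
  by move=> cG; apply: (@continuous_comp _ _ _ (fun t => sg * t) G) => //; exact: sg_continuous.
move: (sg * t) => {}t; rewrite /G /g_.
have ce (c : R) : expR (c * r) @[r --> t] --> expR (c * t).
  apply: (@continuous_comp _ _ _ (fun r => c * r) expR); last exact: continuous_expR.
  by apply: cvgM; [exact: cvg_cst|exact: cvg_id].
apply: cvgM; last exact: ce.
have c1 : x * expR (- (alpha_ l * r)) @[r --> t] --> x * expR (- (alpha_ l * t)).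
  apply: cvgM; first exact: cvg_cst.
  by have := ce (- alpha_ l); under eq_fun do rewrite mulNr; rewrite mulNr.
have c2 : expR r @[r --> t] --> expR t by exact: continuous_expR.
pose k r := (x * expR (- (alpha_ l * r)), expR r).
have ck : {for t, continuous k} by exact: cvg_pair c1 c2.
have cf := differentiable_continuous (f_diff (x * expR (- (alpha_ l * t))) _ (expR_gt0 t)).
exact: (@continuous_comp _ _ _ k (fun p : R * R => f p.1 p.2) t ck cf).
Qed.

Let h_continuous : continuous (fun t => h (expR (sg * t))).
Proof.
move=> t; apply: (@continuous_comp _ _ _ (fun t => expR (sg * t)) h).
  by apply: (@continuous_comp _ _ _ (fun t => sg * t) expR);
    [exact: sg_continuous|exact: continuous_expR].
apply: differentiable_continuous; apply/derivable1_diffP/h_diff; exact: expR_gt0.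
Qed.

(** The slope at zero reduces to a multiple of [h - e], since [dg_] vanishes there; its limit is
    [h_lim]. Equicontinuity is the uniformity of [dg_] on a compact interval, rescaled by
    [|a - b|]. *)
Lemma fowler_admissible : admissible fowler_F fowler_dF.
Proof.
split; split.
- by move=> t; rewrite /fowler_F mul0r mulr0 (g0 _).1 subrr mulr0.
- move=> w t; have h1 := is_derive_g (w / (a - b)) (sg * t).
  have h2 : is_derive w 1 (fun z : R => z / (a - b)) (a - b)^-1.
    by apply: is_derive_eq; rewrite /GRing.scale /=; ring.
  have h3 := @is_derive1_comp _ (fun z => g_ f l z (sg * t)) (fun z => z / (a - b)) w _ _ h1 h2.
  have h4 : is_derive w 1 (fun z : R => g_ f l (z / (a - b)) (sg * t))
    (dg_ f l (w / (a - b)) (sg * t) * (a - b)^-1) := h3.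
  by rewrite /fowler_F; apply: is_derive_eq; rewrite /fowler_dF /GRing.scale /=; ring.
- move=> w t; rewrite /fowler_F; apply: cvgM; first exact: cvg_cst.
  apply: cvgB; last exact: g_continuous.
  apply: cvgM; last exact: cvg_cst.
  by apply: cvgN; apply: cvgB; [exact: h_continuous|exact: cvg_cst].
- have d0 : 0 < `|a - b| by rewrite normr_gt0.
  move=> tau K d dp.
  have dd : 0 < d * `|a - b| by rewrite mulr_gt0.
  have [c c0 hc] := dg_unif tau _ (@segment_compact _ (- (K / `|a - b|)) (K / `|a - b|)) _ dd.
  have inK w : `|w| <= K -> `[- (K / `|a - b|), K / `|a - b|]%classic (w / (a - b)).
    move=> wK; rewrite /= in_itv /= -ler_norml normrM normfV.
    by rewrite ler_wpM2r // invr_ge0 ltW.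
  exists (c * `|a - b|); first by rewrite mulr_gt0.
  move=> w w' t wK wK' tt ww'.
  have -> : fowler_dF w t - fowler_dF w' t = - (sg * ((dg_ f l (w / (a - b)) (sg * t)
    - dg_ f l (w' / (a - b)) (sg * t)) / (a - b))) by rewrite /fowler_dF; ring.
  rewrite normrN normrM norm_sg mul1r normrM normfV ltr_pdivrMr //.
  apply: hc => //; [exact: inK|exact: inK|].
  by rewrite -mulrBl normrM normfV ltr_pdivrMr.
- have d0 : 0 < `|a - b| by rewrite normr_gt0.
  move=> d dp; have [|T hT] := h_lim (d * `|a - b|); first by rewrite mulr_gt0.
  exists T => t tT; rewrite /fowler_dF mul0r (g0 _).2 mul0r subr0.
  rewrite normrM norm_sg mul1r normrM normfV normrN ler_pdivrMr //; exact: hT.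
Qed.

(* [tildeWu] for [sg = 1] and [tildeWs] for [sg = -1] *)
Definition tildeW (tau : R) : set (R * R) := [set Q | exists (J : set R) (X : R -> R * R),
  [/\ trajectory n f h l tau Q J X, forall t, t <= sg * tau -> J (sg * t)
    & forall d : R, 0 < d -> exists T : R, forall t, t <= T ->
        `|(X (sg * t)).1| <= d /\ `|(X (sg * t)).2| <= d]].

Local Notation pm := (planar_map (a - b)^-1 (- (a - b)^-1) (- b / (a - b)) (a / (a - b))).
Local Notation W := (backward_set (sg * (alpha_ l - b)) (sg * (a - alpha_ l)) fowler_F).

Let sgK t : sg * (sg * t) = t.
Proof. by rewrite mulrA sg2 mul1r. Qed.

Let gammaE : gamma_ n l = alpha_ l - a - b.
Proof. by rewrite /gamma_ -addrA -opprB -ab_sum; ring. Qed.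

(** [pm] inverts [u = y + a * x], [v = y + b * x]. As [gamma_] is [alpha_ - a - b] and [a * b = e],
    the rates are [alpha_ - b] and [alpha_ - a], with the common remainder [- (h - e) * x - g_]. *)
Lemma tildeWE tau : tildeW tau = pm @` W (sg * tau).
Proof.
have d0 := ab_neq.
apply/seteqP; split => [Q [J [X [[oJ _ Jtau XQ dX] Jle X0]]]|].
  have [/= d dp hd] : nbhs tau J by apply: open_nbhs_nbhs; split.
  pose u t := (X (sg * t)).2 + a * (X (sg * t)).1.
  pose v t := (X (sg * t)).2 + b * (X (sg * t)).1.
  have Jt t : t < sg * tau + d -> J (sg * t).
    move=> td; have [|tt] := leP t (sg * tau); first exact: Jle.
    apply: hd => /=.
    have -> : tau - sg * t = sg * (sg * tau - t) by rewrite mulrBr sgK.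
    by rewrite normrM norm_sg mul1r ler0_norm; lra.
  have xE t : (X (sg * t)).1 = (u t - v t) / (a - b) by rewrite /u /v; field.
  have yE t : (X (sg * t)).2 = (a * v t - b * u t) / (a - b) by rewrite /u /v; field.
  have dx (t : R) : t < sg * tau + d -> is_derive t 1 (fun r => (X (sg * r)).1)
     (sg * (alpha_ l * (X (sg * t)).1 + (X (sg * t)).2)).
    move=> /Jt /dX[h1 _]; exact: (is_derive_sg (fun r => (X r).1)).
  have dy (t : R) : t < sg * tau + d -> is_derive t 1 (fun r => (X (sg * r)).2)
     (sg * (- h (expR (sg * t)) * (X (sg * t)).1 + gamma_ n l * (X (sg * t)).2
        - g_ f l (X (sg * t)).1 (sg * t))).
    move=> /Jt /dX[_ h1]; exact: (is_derive_sg (fun r => (X r).2)).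
  exists (u (sg * tau), v (sg * tau)); last first.
    by rewrite /u /v sgK XQ /planar_map /=; case: Q XQ => x y XQ /=; congr (_, _); field.
  (* [d] is the radius of a ball around [tau] contained in the open domain [J]. *)
  exists (sg * tau + d), u, v; split=> //; split.
  - by rewrite ltrDl.
  - move=> t td; have h1 := dx t td; have h2 := dy t td.
    rewrite /u; apply: is_derive_eq; rewrite /fowler_F -xE /u -ab_prod gammaE /GRing.scale /=.
    ring.
  - move=> t td; have h1 := dx t td; have h2 := dy t td.
    rewrite /v; apply: is_derive_eq; rewrite /fowler_F -xE /v -ab_prod gammaE /GRing.scale /=.
    ring.
  - move=> c cp; pose c' := c / (1 + `|a| + `|b|).
    have k0 : 0 < 1 + `|a| + `|b| by have := normr_ge0 a; have := normr_ge0 b; lra.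
    have c'0 : 0 < c' by rewrite divr_gt0.
    have [T hT] := X0 _ c'0; exists T => t tT; have [h1 h2] := hT t tT.
    have cE : c = c' + `|a| * c' + `|b| * c' by rewrite /c'; field; rewrite lt0r_neq0.
    have bound (k : R) : `|k| * c' <= `|a| * c' + `|b| * c' ->
        `|(X (sg * t)).2 + k * (X (sg * t)).1| <= c.
      move=> hk; apply: le_trans (ler_normD _ _) _; rewrite cE -addrA; apply: lerD => //.
      by rewrite normrM; apply: le_trans hk; rewrite ler_wpM2l.
    split; apply: bound.
      by rewrite lerDl mulr_ge0 // ltW.
    by rewrite lerDr mulr_ge0 // ltW.
move=> _ [_ [t1 [u [v [[tt1 du dv uv0] <-]]]] <-].
pose X t := pm (u (sg * t), v (sg * t)).
exists [set t | sg * t < t1], X; split.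
- have XE t : X t = ((u (sg * t) - v (sg * t)) / (a - b),
      (a * v (sg * t) - b * u (sg * t)) / (a - b)).
    by rewrite /X /planar_map /=; congr (_, _); field.
  split.
  + have -> : [set t | sg * t < t1] = (fun t => sg * t) @^-1` `]-oo, t1[%classic.
      by apply/seteqP; split => t /=; rewrite in_itv.
    by apply: open_comp => [t _|]; [exact: sg_continuous|exact: lray_open].
  + move=> x y /= hx hy z /andP[xz zy].
    have [s1|s1] := leP 0 sg.
      by apply: le_lt_trans hy; rewrite ler_wpM2l.
    by apply: le_lt_trans hx; rewrite ler_wnM2l // ltW.
  + by [].
  + by [].
  + move=> t tt.
    have x1 : (X t).1 = (u (sg * t) - v (sg * t)) / (a - b) by rewrite XE.
    have x2 : (X t).2 = (a * v (sg * t) - b * u (sg * t)) / (a - b) by rewrite XE.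
    rewrite x1 x2.
    have h1 := is_derive_sg _ _ _ (du (sg * t) tt).
    have h2 := is_derive_sg _ _ _ (dv (sg * t) tt).
    have eF : fowler_F (u (sg * t) - v (sg * t)) (sg * t) =
       sg * (- (h (expR t) - e) * ((u (sg * t) - v (sg * t)) / (a - b))
             - g_ f l ((u (sg * t) - v (sg * t)) / (a - b)) t).
      by rewrite /fowler_F sgK.
    rewrite eF in h1; rewrite eF in h2.
    have kill (y : R) : sg * (sg * y) = y by rewrite mulrA sg2 mul1r.
    have {}h1 : is_derive t 1 (fun r => u (sg * r)) ((alpha_ l - b) * u (sg * t)
        + (- (h (expR t) - e) * ((u (sg * t) - v (sg * t)) / (a - b))
           - g_ f l ((u (sg * t) - v (sg * t)) / (a - b)) t)).
      by apply: is_derive_eq; rewrite mulrDr kill -mulrA kill.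
    have {}h2 : is_derive t 1 (fun r => v (sg * r)) (- (a - alpha_ l) * v (sg * t)
        + (- (h (expR t) - e) * ((u (sg * t) - v (sg * t)) / (a - b))
           - g_ f l ((u (sg * t) - v (sg * t)) / (a - b)) t)).
      by apply: is_derive_eq; rewrite mulrDr kill -mulrN -mulrA kill.
    have X1 : (fun r => (X r).1) = fun r => (u (sg * r) - v (sg * r)) / (a - b).
      by apply/funext => r; rewrite XE.
    have X2 : (fun r => (X r).2) = fun r => (a * v (sg * r) - b * u (sg * r)) / (a - b).
      by apply/funext => r; rewrite XE.
    split.
    * rewrite X1; apply: is_derive_eq; rewrite /GRing.scale /=; field; exact: d0.
    * rewrite X2; apply: is_derive_eq; rewrite gammaE -ab_prod /GRing.scale /=.
      by field; exact: d0.
- move=> t tt /=; rewrite sgK; exact: le_lt_trans tt tt1.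
- move=> c cp; pose k := 1 + `|(a - b)^-1| + `|- (a - b)^-1| + `|- b / (a - b)| + `|a / (a - b)|.
  have k1 := normr_ge0 (a - b)^-1; have k2 := normr_ge0 (- (a - b)^-1).
  have k3 := normr_ge0 (- b / (a - b)); have k4 := normr_ge0 (a / (a - b)).
  have k0 : 0 < k by rewrite /k; lra.
  have c'0 : 0 < c / k by rewrite divr_gt0.
  have [T hT] := uv0 _ c'0; exists T => t tT; have [h1 h2] := hT t tT.
  have cE : c = k * (c / k) by field; rewrite lt0r_neq0.
  have bound (x y : R) : `|x| + `|y| <= k -> `|x * u t + y * v t| <= c.
    move=> hk; apply: le_trans (ler_normD _ _) _; rewrite !normrM cE.
    apply: (@le_trans _ _ ((`|x| + `|y|) * (c / k))); last by rewrite ler_wpM2r // ltW.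
    by rewrite mulrDl; apply: lerD; rewrite ler_wpM2l.
  by rewrite /X !sgK /planar_map /=; split; apply: bound; rewrite /k; lra.
Qed.

Lemma component_immersed (tau : R) :
  let C := connected_component (tildeW tau) (0, 0) in
  [/\ immersed_1manifold C, C (0, 0), connected C & C `<=` tildeW tau].
Proof.
move=> C.
have T00 : tildeW tau (0, 0).
  rewrite tildeWE; exists (0, 0); last by rewrite /planar_map /= !mulr0 !addr0.
  exists (sg * tau + 1), (fun=> 0), (fun=> 0); split => //.
  have F00 t : fowler_F (0 - 0) t = 0 by rewrite subrr; have [[-> _ _] _] := fowler_admissible.
  split.
  - by rewrite ltrDl.
  - by move=> t _; apply: is_derive_eq; rewrite F00; ring.
  - by move=> t _; apply: is_derive_eq; rewrite F00; ring.
  - by move=> d d0; exists 0 => t _; rewrite normr0 ltW.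
have C00 : C (0, 0) by exact: connected_component_refl.
split => //; last 2 first.
- exact: component_connected.
- exact: connected_component_sub.
have det : (a - b)^-1 * (a / (a - b)) - - (a - b)^-1 * (- b / (a - b)) != 0.
  have -> : (a - b)^-1 * (a / (a - b)) - - (a - b)^-1 * (- b / (a - b)) = (a - b)^-1.
    by field.
  by rewrite invr_eq0.
have [V [c Vc]] := @backward_set_charts R _ _ _ _ (sg * tau) lam_gt0 mu_gt0
  fowler_admissible _ _ _ _ det.
rewrite -tildeWE in Vc.
apply: immersed_of_charts (chart_family_component _ _ _ (0, 0) Vc) _.
by exists (0, 0).
Qed.

End fowler_reduction.

(** * Critical exponents and roots of the characteristic polynomial *)

Section exponents.
Context {R : realType}.
Variables (n e l : R).
Hypotheses (n_gt2 : 2 < n) (e_lt : e < hardy_const n).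
Let s := Num.sqrt ((n - 2) ^+ 2 - 4 * e).

Let s2 : s * s = (n - 2) * (n - 2) - 4 * e.
Proof.
by rewrite -expr2 sqr_sqrtr ?expr2 //; move: e_lt; rewrite /hardy_const expr2; lra.
Qed.

Lemma discriminant_gt0 : 0 < s.
Proof. by rewrite sqrtr_gt0; move: e_lt; rewrite /hardy_const; lra. Qed.

Lemma char_prod : (n - 2 + s) / 2 * ((n - 2 - s) / 2) = e.
Proof.
have -> : (n - 2 + s) / 2 * ((n - 2 - s) / 2) = ((n - 2) * (n - 2) - s * s) / 4 by field.
by rewrite s2; field.
Qed.

(** The critical exponents are [2 + 4 / (n - 2 + s)] and [2 + 4 / (n - 2 - s)], so comparing [l]
    with them compares [2 / (l - 2)] with the roots. When the smaller root is not positive, the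
    lower bound follows from [alpha_ l > 0]. *)
Lemma alpha_between : two_star n e < l -> (l%:E < I_exp n e)%E ->
  (n - 2 - s) / 2 < alpha_ l < (n - 2 + s) / 2.
Proof.
have s0 := discriminant_gt0; have n2 : 0 < n - 2 by move: n_gt2; lra.
rewrite /two_star -/s => hl hI.
have k0 : 0 < n - 2 + s by lra.
have hl' : 4 < (l - 2) * (n - 2 + s).
  move: hl; rewrite mulrA ltr_pdivrMr //; lra.
have l2 : 0 < l - 2.
  by rewrite -(pmulr_lgt0 _ k0); lra.
apply/andP; split; last by rewrite /alpha_ ltr_pdivrMr // mulrAC ltr_pdivlMr // mulrC; lra.
have [c0|c0] := leP (n - 2 - s) 0.
  by apply: (@le_lt_trans _ _ 0); [lra|rewrite /alpha_ divr_gt0].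
move: hI; rewrite /I_exp -/s ifF; last first.
  apply/negbTE; rewrite -ltNge -char_prod mulr_gt0 //; lra.
rewrite lte_fin mulrA ltr_pdivlMr // => hI.
by rewrite /alpha_ ltr_pdivlMr //; lra.
Qed.

End exponents.

(** * Unstable and stable sets as the two time directions of one set *)

Section manifolds.
Context {R : realType}.
Variables (n : R) (f : R -> R -> R) (h : R -> R) (l : R).

Lemma tildeWuE (tau : R) : tildeWu n f h l tau = tildeW n f h l 1 tau.
Proof.
apply/seteqP; split => Q [J [X [tr hJ X0]]]; exists J, X; split => //.
- by move=> t; rewrite !mul1r; exact: hJ.
- move=> d d0.
  have X1 : (X t).1 @[t --> -oo] --> (0 : R) by exact: (cvg_comp _ _ X0 cvg_fst).
  have X2 : (X t).2 @[t --> -oo] --> (0 : R) by exact: (cvg_comp _ _ X0 cvg_snd).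
  move/cvgrPdist_le : X1 => /(_ _ d0)[T1 [_ h1]].
  move/cvgrPdist_le : X2 => /(_ _ d0)[T2 [_ h2]].
  (* The shift by 1 turns [t <= T] into the strict inequalities of the filter at [-oo]. *)
  exists (Num.min T1 T2 - 1) => t tT; rewrite mul1r.
  have t1 : t < T1.
    by apply: le_lt_trans tT _; rewrite ltrBlDr (@le_lt_trans _ _ T1) ?ge_min ?lexx// ltrDl.
  have t2 : t < T2.
    apply: le_lt_trans tT _.
    by rewrite ltrBlDr (@le_lt_trans _ _ T2) ?ge_min ?lexx ?orbT// ltrDl.
  by split; rewrite -normrN -[- _]sub0r; [exact: h1|exact: h2].
- by move=> t tt; have := hJ t; rewrite !mul1r; exact.
- have X1 : (X t).1 @[t --> -oo] --> (0 : R).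
    apply/cvgrPdist_le => d d0; have [T hT] := X0 d d0.
    exists T; split; first exact: num_real.
    by move=> t /ltW /hT[]; rewrite mul1r sub0r normrN.
  have X2 : (X t).2 @[t --> -oo] --> (0 : R).
    apply/cvgrPdist_le => d d0; have [T hT] := X0 d d0.
    exists T; split; first exact: num_real.
    by move=> t /ltW /hT[_]; rewrite mul1r sub0r normrN.
  have -> : X = fun t => ((X t).1, (X t).2) by apply/funext => t; case: (X t).
  exact: cvg_pair X1 X2.
Qed.

Lemma tildeWsE (tau : R) : tildeWs n f h l tau = tildeW n f h l (- 1) tau.
Proof.
apply/seteqP; split => Q [J [X [tr hJ X0]]]; exists J, X; split => //.
- by move=> t; rewrite !mulN1r => tt; apply: hJ => /=; lra.
- move=> d d0.
  have X1 : (X t).1 @[t --> +oo] --> (0 : R) by exact: (cvg_comp _ _ X0 cvg_fst).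
  have X2 : (X t).2 @[t --> +oo] --> (0 : R) by exact: (cvg_comp _ _ X0 cvg_snd).
  move/cvgrPdist_le : X1 => /(_ _ d0)[T1 [_ h1]].
  move/cvgrPdist_le : X2 => /(_ _ d0)[T2 [_ h2]].
  exists (- (`|T1| + `|T2| + 1)) => t tT; rewrite mulN1r.
  have n1 := ler_norm T1; have n2 := ler_norm T2.
  have m1 := normr_ge0 T1; have m2 := normr_ge0 T2.
  have t1 : T1 < - t by lra.
  have t2 : T2 < - t by lra.
  by split; rewrite -normrN -sub0r; [exact: h1|exact: h2].
- by move=> t tt; have := hJ (- t); rewrite !mulN1r opprK; apply; rewrite lerN2.
- have lim (z : R * R -> R) :
      (forall d, 0 < d -> exists T, forall t, t <= T -> `|z (X (-1 * t))| <= d) ->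
      z (X t) @[t --> +oo] --> (0 : R).
    move=> hz; apply/cvgrPdist_le => d d0; have [T hT] := hz d d0.
    exists (- T); split; first exact: num_real.
    move=> t tT; have := hT (- t); rewrite mulN1r opprK sub0r normrN; apply; lra.
  have X1 : (X t).1 @[t --> +oo] --> (0 : R).
    by apply: (lim fst) => d d0; have [T hT] := X0 d d0; exists T => t /hT[].
  have X2 : (X t).2 @[t --> +oo] --> (0 : R).
    by apply: (lim snd) => d d0; have [T hT] := X0 d d0; exists T => t /hT[].
  have -> : X = fun t => ((X t).1, (X t).2) by apply/funext => t; case: (X t).
  exact: cvg_pair X1 X2.
Qed.

Lemma limit_at_zero (eta : R) : h r @[r --> 0^'+] --> eta ->
  forall d : R, 0 < d -> exists T : R, forall t, t <= T -> `|h (expR (1 * t)) - eta| <= d.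
Proof.
move=> /cvgrPdist_le hl d d0; have [/= c c0 hc] := hl d d0.
have [x x0] := expR_small 1 c ltr01 c0; rewrite mul1r => xc.
exists (- x) => t tx; rewrite mul1r distrC; apply: hc; rewrite /= ?expR_gt0 //.
rewrite sub0r normrN gtr0_norm ?expR_gt0 //.
by apply: le_lt_trans xc; rewrite ler_expR.
Qed.

Lemma limit_at_infinity (beta : R) : h r @[r --> +oo%R] --> beta ->
  forall d : R, 0 < d -> exists T : R, forall t, t <= T ->
    `|h (expR (- 1 * t)) - beta| <= d.
Proof.
move=> /cvgrPdist_le hl d d0; have [M [_ hM]] := hl d d0.
exists (- M) => t tM; rewrite mulN1r distrC; apply: hM.
by apply: lt_le_trans (expR_ge1Dx _); lra.
Qed.

End manifolds.

Theorem lemma2p12 (R : realType) (n : R) (f : R -> R -> R) (h : R -> R)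
    (eta beta lu ls : R)
    (n_gt2 : 2 < n)
    (f_diff : forall u r : R, 0 < r ->
       differentiable (fun p : R * R => f p.1 p.2) (u, r))
    (f0 : forall r : R, 0 < r -> f 0 r = 0)
    (hH : condH n h eta beta)
    (hgu : cond_gu n f eta lu)
    (hgs : cond_gs n f beta ls)
    (tau : R) :
  [/\ immersed_1manifold (Wu n f h lu tau),
      Wu n f h lu tau (0, 0),
      connected (Wu n f h lu tau)
    & Wu n f h lu tau `<=` tildeWu n f h lu tau] /\
  [/\ immersed_1manifold (Ws n f h ls tau),
      Ws n f h ls tau (0, 0),
      connected (Ws n f h ls tau)
    & Ws n f h ls tau `<=` tildeWs n f h ls tau].
Proof.
have [[h_diff _] [[h_eta eta_lt _] [h_beta beta_lt _]]] := hH.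
split.
- have [l1 l2 uc g0] := hgu.
  have s0 := discriminant_gt0 n eta eta_lt.
  have prod := char_prod n eta eta_lt.
  have /andP[a1 a2] := alpha_between n eta lu n_gt2 eta_lt l1 l2.
  set s := Num.sqrt _ in s0 prod a1 a2.
  rewrite /Wu tildeWuE.
  (* With the larger root as [a], both [alpha_ lu - b] and [a - alpha_ lu] are positive. *)
  apply: (@component_immersed R n f h lu eta ((n - 2 + s) / 2) ((n - 2 - s) / 2) 1) => //.
  + by field.
  + by apply: lt0r_neq0; lra.
  + by rewrite mul1r.
  + by lra.
  + by lra.
  + exact: limit_at_zero.
  + move=> t K cK c c0; have [d d0 hd] := (uc t).2 K cK c c0.
    exists d; first exact: d0.
    move=> x x' r Kx Kx' rt xx'.
    by apply: hd; rewrite //= mul1r.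
- have [l1 l2 uc g0] := hgs.
  have s0 := discriminant_gt0 n beta beta_lt.
  have prod := char_prod n beta beta_lt.
  have /andP[a1 a2] := alpha_between n beta ls n_gt2 beta_lt l1 l2.
  set s := Num.sqrt _ in s0 prod a1 a2.
  rewrite /Ws tildeWsE.
  (* Reversing time changes the sign of both rates, so the two roots are exchanged to keep them
     positive. *)
  apply: (@component_immersed R n f h ls beta ((n - 2 - s) / 2) ((n - 2 + s) / 2) (- 1)) => //.
  + by field.
  + by rewrite mulrC.
  + by apply: ltr0_neq0; lra.
  + by rewrite mulrNN mul1r.
  + by lra.
  + by lra.
  + exact: limit_at_infinity.
  + move=> t K cK c c0; have [d d0 hd] := (uc (- t)).2 K cK c c0.
    exists d; first exact: d0.
    move=> x x' r Kx Kx' rt xx'.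
    by apply: hd; rewrite //= mulN1r lerN2.
Qed.
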